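(* Let $L>0$, $T>0$, $\ell>1/2$ and $n\in\mathbb{N}_0$, and let $\mathcal{L}:\mathcal{D}(\mathcal{L})\to H^\ell_{\mathrm{per}}(0,L)$ be the generator of a strongly continuous semigroup $e^{t\mathcal{L}}$ on $H^\ell_{\mathrm{per}}(0,L)$. Assume that $e^{t\mathcal{L}}\partial_x^n$, defined on the dense domain $H^{\ell+n}_{\mathrm{per}}(0,L)$, extends to a bounded linear operator $B_n(t)$ on $H^\ell_{\mathrm{per}}(0,L)$ for all $t\in(0,T)$, and that there are a constant $C'>0$ and $\gamma\in[0,1)$ such that $$\|B_n(t)u\|_{H^\ell_{\mathrm{per}}}\le C' t^{-\gamma}\|u\|_{H^\ell_{\mathrm{per}}}\qquad\text{for all } t\in(0,T),\ u\in H^\ell_{\mathrm{per}}(0,L).$$ Let $\rho:\mathbb{C}\to\mathbb{C}$ be real analytic with power series $\rho(z)=\sum_{a,b\ge0,\ a+b\ge2}\alpha_{a,b}z^a\bar z^b$ satisfying $\sum_{a,b\ge0,\ a+b\ge2}|\alpha_{a,b}|r^{a+b}<\infty$ for all $r<R$, where $0<R\le\infty$; let $\mathcal{N}_\rho$ be the associated resonant nonlinearity (defined in the context), $\mathcal{B}_R$ the open ball of radius $R$ centred at $0$ in $H^\ell_{\mathrm{per}}(0,L)$, and $\tau_P=\frac{L^2}{2\pi}$. Then $u\in C^0([0,T];\mathcal{B}_R)$ is a mild solution to $$\partial_t u=\mathcal{L}u+\partial_x^n\mathcal{N}_\rho(u),\quad\text{i.e.}\quad u(t)=e^{t\mathcal{L}}u(0)+\int_0^t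 B_n(t-s)\,\mathcal{N}_\rho(u(s))\,ds\quad (t\in[0,T]),$$ if and only if there is a pair $(v,w)\in C^0([0,T]\times[0,\tau_P];\mathcal{B}_R\times H^\ell_{\mathrm{per}}(0,L))$ such that the triple $(u,v,w)$ is a mild solution to the extended local problem $$\partial_t u=\mathcal{L}u+\tau_P^{-1}\partial_x^n w(\cdot,\tau_P),\qquad \partial_\tau v=i\,\partial_x^2v,\qquad \partial_\tau w=i\,\partial_x^2w+\rho(v)$$ with $(v,w)(t,0)=(u(t),0)$ for $t\in[0,T]$.
   Context: For $\ell>1/2$, $H^\ell_{\mathrm{per}}(0,L)$ is the Sobolev space of complex-valued periodic functions $u(x)=\sum_{K\in\mathbb{Z}}\hat u_K e^{2\pi i Kx/L}$ on $(0,L)$, with norm $\|u\|_{H^\ell_{\mathrm{per}}}=C\big(\sum_{K\in\mathbb{Z}}(1+|K|^2)^\ell|\hat u_K|^2\big)^{1/2}$, where the constant $C>0$ is fixed large enough that the norm is submultiplicative ($\|uv\|_{H^\ell_{\mathrm{per}}}\le\|u\|_{H^\ell_{\mathrm{per}}}\|v\|_{H^\ell_{\mathrm{per}}}$) and $\|u\|_{L^\infty(0,L)}\le\|u\|_{H^\ell_{\mathrm{per}}}$. The power series representation of $\rho$ is understood for $|z|<R$. Resonant nonlinearity: for $u\in H^\ell_{\mathrm{per}}(0,L)$ with $\|u\|_{H^\ell_{\mathrm{per}}}<R$, $\mathcal{N}_\rho(u)$ is defined through its Fourier coefficients $$\widehat{\mathcal{N}_\rho(u)}_K=\sum_{a,b\ge0,\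 a+b\ge2}\alpha_{a,b}\Big[\sum_{(\mathbf j,\mathbf k)\in\mathcal{R}_{a,b}(K)}\prod_{m=1}^a\hat u_{\mathbf j_m}\prod_{m=1}^b\overline{\hat u_{\mathbf k_m}}\Big],\quad K\in\mathbb{Z},$$ where $$\mathcal{R}_{a,b}(K)=\Big\{(\mathbf j,\mathbf k)\in\mathbb{Z}^a\times\mathbb{Z}^b: K^2=|\mathbf j|^2-|\mathbf k|^2\ \text{and}\ K=\sum_{m=1}^a\mathbf j_m-\sum_{m=1}^b\mathbf k_m\Big\},$$ with $|\mathbf j|^2=\sum_m\mathbf j_m^2$; empty sums are $0$ and empty products are $1$. Schrödinger group: $S_\tau=e^{i\tau\partial_x^2}$ acts on $H^\ell_{\mathrm{per}}(0,L)$ by $S_\tau u=\sum_{K\in\mathbb{Z}}e^{-i\tau(2\pi K/L)^2}\hat u_K e^{2\pi iKx/L}$; it is $\tau_P$-periodic in $\tau$. A triple $(u,v,w)$ is a mild solution of the extended local problem with $(v,w)(t,0)=(u(t),0)$ if for all $t\in[0,T]$ and $\tau\in[0,\tau_P]$: $u(t)=e^{t\mathcal{L}}u(0)+\tau_P^{-1}\int_0^tB_n(t-s)\,w(s,\tau_P)\,ds$, $v(t,\tau)=S_\tau u(t)$, and $w(t,\tau)=\int_0^\tau S_{\tau-s}\,\rho(v(t,s))\,ds$. Here $\rho(v)$ denotes pointwise composition and integrals are Bochner integrals in $H^\ell_{\mathrm{per}}(0,L)$. *)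

(* Defs.v *)
From HB Require Import structures.
From mathcomp Require Import all_boot all_order all_algebra.
From mathcomp Require Import complex.
From mathcomp Require Import all_classical all_reals all_analysis.
From mathcomp Require Import ring.

Set Implicit Arguments.
Unset Strict Implicit.
Unset Printing Implicit Defensive.

Import Order.TTheory GRing.Theory Num.Theory.
Import ComplexField.Normc.
Import numFieldNormedType.Exports.

Local Open Scope classical_set_scope.
Local Open Scope ring_scope.
Local Open Scope complex_scope.

(* [R[i]] carries its topology only through the alias [R[i]^o]; complex moduli
   are taken in [R] by [normc]. *)

Definition expi (R : realType) (x : R) : R[i] := cos x +i* sin x.

(* Sum of an absolutely summable family over a countable index set (the
   integral for the counting measure). *)
Definition rsum (R : realType) (I : choiceType) (D : set I) (f : I -> R) : R :=
  fine (\esum_(i in D) (Num.max (f i) 0)%:E) -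
  fine (\esum_(i in D) (Num.max (- f i) 0)%:E).

Definition csum (R : realType) (I : choiceType) (D : set I) (f : I -> R[i]) :
    R[i] :=
  rsum D (fun i => complex.Re (f i)) +i* rsum D (fun i => complex.Im (f i)).

Section SobolevEnergy.
Variables (R : realType) (l : R).
Implicit Types (c d : int -> R[i]^o).

Definition sob_weight (K : int) : R := (1 + K%:~R ^+ 2) `^ l.

Definition sob_energy c : \bar R :=
  \esum_(K in [set: int]) (sob_weight K * normc (c K) ^+ 2)%:E.

Definition in_sobolev : {pred int -> R[i]^o} :=
  [pred c | (sob_energy c < +oo)%E].

Lemma sob_weight_gt0 K : 0 < sob_weight K.
Proof. by rewrite powR_gt0// ltr_pwDl// sqr_ge0. Qed.

Lemma sob_term_ge0 c K : (0 <= (sob_weight K * normc (c K) ^+ 2)%:E)%E.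
Proof. by rewrite lee_fin mulr_ge0 ?sqr_ge0// ltW// sob_weight_gt0. Qed.

Lemma sob_energy_ge0 c : (0 <= sob_energy c)%E.
Proof. by apply: esum_ge0 => K _; exact: sob_term_ge0. Qed.

Lemma esumZl (T : choiceType) (S : set T) (a : T -> \bar R) (k : R) :
  0 <= k -> (forall i, 0 <= a i)%E ->
  (\esum_(i in S) (k%:E * a i) = k%:E * \esum_(i in S) a i)%E.
Proof.
have le (r : R) (b : T -> \bar R) : 0 <= r -> (forall i, 0 <= b i)%E ->
    (\esum_(i in S) (r%:E * b i) <= r%:E * \esum_(i in S) b i)%E.
  move=> r0 b0; apply: ge_ereal_sup => _ [F [finF FS] <-].
  rewrite -ge0_mule_fsumr//; apply: lee_pmul => //.
    by apply: fsume_ge0.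
  by apply: esum_ge; exists F.
rewrite le_eqVlt => /predU1P[<- a0|k0 a0].
  by rewrite mul0e esum1// => i _; rewrite mul0e.
apply/eqP; rewrite eq_le; apply/andP; split; first by apply: le => //; exact: ltW.
rewrite -lee_pdivlMl//.
have k'0 : 0 <= k^-1 by rewrite invr_ge0 ltW.
have ka0 i : (0 <= k%:E * a i)%E by rewrite mule_ge0// lee_fin ltW.
apply: le_trans (le _ _ k'0 ka0).
by apply: le_esum => i _; rewrite muleA -EFinM mulVf ?gt_eqF// mul1e.
Qed.

Lemma normc_young (a b : R[i]) (s : R) : 0 < s ->
  normc (a + b) ^+ 2 <= (1 + s) * normc a ^+ 2 + (1 + s^-1) * normc b ^+ 2.
Proof.
move=> s0; have nab : normc (a + b) <= normc a + normc b.
  exact: le_normcD.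
have na : 0 <= normc (a + b) by case: (a + b) => ? ?; exact: sqrtr_ge0.
apply: (@le_trans _ _ ((normc a + normc b) ^+ 2)).
  by rewrite ler_sqr ?nnegrE//; exact: le_trans na nab.
rewrite -subr_ge0 [X in 0 <= X](_ : _ = s^-1 * (s * normc a - normc b) ^+ 2).
  by rewrite mulr_ge0 ?sqr_ge0// invr_ge0 ltW.
by field; exact: lt0r_neq0.
Qed.

Lemma sob_energyD_le c d (s : R) : 0 < s ->
  (sob_energy (c + d)%R <=
   (1 + s)%:E * sob_energy c + (1 + s^-1)%:E * sob_energy d)%E.
Proof.
move=> s0.
have s1 : 0 <= 1 + s by rewrite addr_ge0// ltW.
have s2 : 0 <= 1 + s^-1 by rewrite addr_ge0// invr_ge0 ltW.
rewrite /sob_energy -!esumZl//; try exact: sob_term_ge0.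
rewrite -esumD; last 2 first.
- by move=> K _; rewrite mule_ge0 ?sob_term_ge0.
- by move=> K _; rewrite mule_ge0 ?sob_term_ge0.
apply: le_esum => K _; rewrite -!EFinM -EFinD lee_fin.
rewrite [X in _ <= X](_ : _ = sob_weight K * ((1 + s) * normc (c K) ^+ 2 +
    (1 + s^-1) * normc (d K) ^+ 2)); last by ring.
by rewrite ler_pM2l ?sob_weight_gt0//; exact: normc_young.
Qed.

Lemma sob_energyZ c (a : R[i]) :
  sob_energy (a *: c) = ((normc a ^+ 2)%:E * sob_energy c)%E.
Proof.
rewrite /sob_energy -esumZl ?sqr_ge0//; last exact: sob_term_ge0.
apply: eq_esum => K _; rewrite -EFinM; congr EFin.
by rewrite /= normcM exprMn; ring.
Qed.

Lemma sob_energy0 : sob_energy 0 = 0%E.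
Proof. by apply: esum1 => K _; rewrite normc0 expr0n mulr0. Qed.

Lemma sob_energy_eq0 c : sob_energy c = 0%E -> c = 0.
Proof.
move=> c0; apply/funext => K; apply: eq0_normc; apply/eqP.
have : ((sob_weight K * normc (c K) ^+ 2)%:E <= sob_energy c)%E.
  by apply: esum_ge; exists [set K]; rewrite ?fsbig_set1.
rewrite c0 lee_fin pmulr_rle0 ?sob_weight_gt0// => h.
by rewrite -sqrf_eq0 eq_le h sqr_ge0.
Qed.

Lemma in_sobolev_submod : submod_closed in_sobolev.
Proof.
split=> [|a c d]; rewrite !inE /=; first by rewrite sob_energy0.
move=> cfin dfin; apply: le_lt_trans (sob_energyD_le (a *: c) d ltr01) _.
rewrite sob_energyZ lte_add_pinfty//; apply: lte_mul_pinfty => //.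
by apply: lte_mul_pinfty; rewrite // lee_fin sqr_ge0.
Qed.

HB.instance Definition _ := GRing.isSubmodClosed.Build _ _ in_sobolev
  in_sobolev_submod.

End SobolevEnergy.

Lemma in_sobolev_fin (R : realType) (l : R) (c : int -> R[i]^o) :
  c \in in_sobolev l -> sob_energy l c \is a fin_num.
Proof. by rewrite inE /= => h; rewrite ge0_fin_numE// sob_energy_ge0. Qed.

(* For [l > 1/2] an element of H^l_per(0, L) is determined by its Fourier
   coefficients, and its Fourier series converges absolutely: elements are
   represented by their coefficients, and [sob_fun] below is the corresponding
   function. The constant [C] of the norm is a parameter of the type because the
   normed-module instance depends on it. *)
Record sobolev (R : realType) (l : R) (C : {posnum R}) := Sobolev {
  coef :> int -> R[i]^o ;
  coefP : coef \in in_sobolev l }.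

HB.instance Definition _ (R : realType) (l : R) (C : {posnum R}) :=
  [isSub for @coef R l C].
HB.instance Definition _ (R : realType) (l : R) (C : {posnum R}) :=
  [Choice of sobolev l C by <:].
HB.instance Definition _ (R : realType) (l : R) (C : {posnum R}) :=
  [SubChoice_isSubLmodule of sobolev l C by <:].

Section SobolevNorm.
Variables (R : realType) (l : R) (C : {posnum R}).
Implicit Types u v : sobolev l C.

Definition sob_norm u : R := C%:num * Num.sqrt (fine (sob_energy l u)).

Let energy_ge0 u : 0 <= fine (sob_energy l u).
Proof. by rewrite fine_ge0// sob_energy_ge0. Qed.

Let energyD_le u v (s : R) : 0 < s -> fine (sob_energy l (u + v)) <=
  (1 + s) * fine (sob_energy l u) + (1 + s^-1) * fine (sob_energy l v).
Proof.
move=> s0; have := sob_energyD_le l u v s0.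
rewrite -[in X in (_ <= X)%E](fineK (in_sobolev_fin (coefP u))).
rewrite -[in X in (_ <= X)%E](fineK (in_sobolev_fin (coefP v))).
by rewrite -[X in (X <= _)%E](fineK (in_sobolev_fin (coefP (u + v)))).
Qed.

Lemma sob_norm_eq0 u : sob_norm u = 0 -> u = 0.
Proof.
move/eqP; rewrite mulf_eq0 gt_eqF//= sqrtr_eq0 => u0.
apply: val_inj; apply: (@sob_energy_eq0 R l).
rewrite -(fineK (in_sobolev_fin (coefP u))); congr EFin.
by apply/eqP; rewrite eq_le u0 energy_ge0.
Qed.

Lemma sob_normZ (a : R[i]) u : sob_norm (a *: u) = normc a * sob_norm u.
Proof.
have na : 0 <= normc a by case: a => ? ?; exact: sqrtr_ge0.
rewrite /sob_norm [coef _](_ : _ = a *: (coef u)); last by [].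
rewrite sob_energyZ fineM ?in_sobolev_fin ?coefP//= sqrtrM ?sqr_ge0//.
by rewrite sqrtr_sqr ger0_norm// mulrCA.
Qed.

Lemma sob_normD u v : sob_norm (u + v) <= sob_norm u + sob_norm v.
Proof.
rewrite -mulrDr ler_pM2l//.
have [u0|u0] := eqVneq (fine (sob_energy l u)) 0.
  rewrite (sob_norm_eq0 (_ : sob_norm u = 0)) ?add0r ?lerDr ?sqrtr_ge0//.
  by rewrite /sob_norm u0 sqrtr0 mulr0.
have [v0|v0] := eqVneq (fine (sob_energy l v)) 0.
  rewrite (sob_norm_eq0 (_ : sob_norm v = 0)) ?addr0 ?lerDl ?sqrtr_ge0//.
  by rewrite /sob_norm v0 sqrtr0 mulr0.
have {}u0 : 0 < fine (sob_energy l u) by rewrite lt_def u0 energy_ge0.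
have {}v0 : 0 < fine (sob_energy l v) by rewrite lt_def v0 energy_ge0.
set y := Num.sqrt (fine (sob_energy l v)).
set z := Num.sqrt (fine (sob_energy l u)).
have y0 : 0 < y by rewrite sqrtr_gt0.
have z0 : 0 < z by rewrite sqrtr_gt0.
have uE : fine (sob_energy l u) = z ^+ 2 by rewrite sqr_sqrtr.
have vE : fine (sob_energy l v) = y ^+ 2 by rewrite sqr_sqrtr.
have zy0 : 0 <= z + y by rewrite addr_ge0 ?sqrtr_ge0.
rewrite -ler_sqr ?nnegrE ?sqrtr_ge0//.
rewrite sqr_sqrtr//; apply: le_trans (energyD_le u v (divr_gt0 y0 z0)) _.
rewrite uE vE le_eqVlt; apply/orP; left; apply/eqP.
by field; rewrite !gt_eqF.
Qed.

Lemma real_sob_normD u v :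
  (sob_norm (u + v))%:C <= (sob_norm u)%:C + (sob_norm v)%:C.
Proof. by rewrite -rmorphD lecR sob_normD. Qed.

Lemma real_sob_normZ (a : R[i]) u :
  (sob_norm (a *: u))%:C = `|a| * (sob_norm u)%:C.
Proof. by rewrite sob_normZ rmorphM /=; congr (_ * _); case: a. Qed.

Lemma real_sob_norm_eq0 u : (sob_norm u)%:C = 0 -> u = 0.
Proof. by case=> /sob_norm_eq0. Qed.

HB.instance Definition _ := Lmodule_isNormed.Build R[i] (sobolev l C)
  real_sob_normD real_sob_normZ real_sob_norm_eq0.

Lemma sob_normE u : `|u| = (sob_norm u)%:C.
Proof. by []. Qed.

End SobolevNorm.

Lemma normc_expi (R : realType) (x : R) : normc (expi x) = 1.
Proof. by rewrite /expi /= cos2Dsin2 sqrtr1. Qed.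

Section SobolevOperators.
Variables (R : realType) (L l : R) (C : {posnum R}).
Local Notation H := (sobolev l C).

Definition sob_fun (u : H) (x : R) : R[i] :=
  csum [set: int] (fun K => u K * expi (2 * pi * K%:~R * x / L)).

Definition schrodinger_coef (tau : R) (c : int -> R[i]^o) : int -> R[i]^o :=
  fun K => expi (- (tau * (2 * pi * K%:~R / L) ^+ 2)) * c K.

Lemma schrodinger_subproof tau (u : H) :
  schrodinger_coef tau u \in in_sobolev l.
Proof.
suff E : sob_energy l (schrodinger_coef tau u) = sob_energy l u.
  by rewrite !inE /= E; have := coefP u; rewrite inE.
by apply: eq_esum => K _; rewrite normcM normc_expi mul1r.
Qed.

Definition schrodinger (tau : R) (u : H) : H :=
  Sobolev C (schrodinger_subproof tau u).

Definition dx_coef (n : nat) (c : int -> R[i]^o) : int -> R[i]^o :=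
  fun K => (0 +i* (2 * pi * K%:~R / L)) ^+ n * c K.

Lemma sob_weightD n K :
  sob_weight (l + n%:R) K = sob_weight l K * (1 + K%:~R ^+ 2) ^+ n :> R.
Proof.
have h : 0 < 1 + K%:~R ^+ 2 :> R by rewrite ltr_pwDl// sqr_ge0.
rewrite /sob_weight powRD ?powR_mulrn ?(ltW h)//.
by rewrite (gt_eqF h) implybT.
Qed.

Lemma sob_embed_subproof n (u : sobolev (l + n%:R) C) :
  coef u \in in_sobolev l.
Proof.
rewrite inE /=; have := coefP u; rewrite inE /=; apply: le_lt_trans.
apply: le_esum => K _; rewrite lee_fin ler_wpM2r ?sqr_ge0// sob_weightD.
rewrite ler_peMr ?exprn_ege1 ?lerDl ?sqr_ge0//.
by rewrite ltW// sob_weight_gt0.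
Qed.

Definition sob_embed n (u : sobolev (l + n%:R) C) : H :=
  Sobolev C (sob_embed_subproof u).

Lemma dx_subproof n (u : sobolev (l + n%:R) C) :
  dx_coef n u \in in_sobolev l.
Proof.
have k0 : 0 <= (2 * pi / L) ^+ 2 ^+ n :> R by rewrite exprn_ge0// sqr_ge0.
suff le : (sob_energy l (dx_coef n u) <=
    ((2 * pi / L) ^+ 2 ^+ n)%:E * sob_energy (l + n%:R) u)%E.
  rewrite inE /=; apply: le_lt_trans le _; apply: lte_mul_pinfty => //.
  by have := coefP u; rewrite inE.
rewrite /sob_energy -esumZl//; last by move=> K; exact: sob_term_ge0.
apply: le_esum => K _; rewrite -EFinM lee_fin sob_weightD.
have -> : normc (dx_coef n u K) ^+ 2 =
    (2 * pi / L) ^+ 2 ^+ n * (K%:~R ^+ 2) ^+ n * normc (u K) ^+ 2.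
  rewrite normcM exprMn; congr (_ * _).
  have -> (z : R[i]) : normc (z ^+ n) ^+ 2 = (normc z ^+ 2) ^+ n.
    elim: n {k0 u} => [|n IH]; first by rewrite !expr0 normc1 expr1n.
    by rewrite (exprS z) normcM exprMn IH [RHS]exprS.
  rewrite /= expr0n add0r sqr_sqrtr ?sqr_ge0// -exprMn; congr (_ ^+ _).
  ring.
rewrite [X in X <= _](_ : _ = ((2 * pi / L) ^+ 2 ^+ n * sob_weight l K *
   normc (u K) ^+ 2) * (K%:~R ^+ 2) ^+ n); last by ring.
rewrite [X in _ <= X](_ : _ = ((2 * pi / L) ^+ 2 ^+ n * sob_weight l K *
   normc (u K) ^+ 2) * (1 + K%:~R ^+ 2) ^+ n); last by ring.
apply: ler_wpM2l.
  by rewrite mulr_ge0 ?sqr_ge0// mulr_ge0// ltW// sob_weight_gt0.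
by rewrite lerXn2r ?nnegrE ?sqr_ge0 ?addr_ge0 ?sqr_ge0 ?lerDr.
Qed.

Definition dx n (u : sobolev (l + n%:R) C) : H :=
  Sobolev C (dx_subproof u).

End SobolevOperators.

(* [C] is large enough that the norm is submultiplicative and dominates the
   sup norm; that [u v] lies in H^l_per is a fact for [l > 1/2], not assumed. *)
Definition sob_constant (R : realType) (L l : R) (C : {posnum R}) : Prop :=
  (forall u v w : sobolev l C,
    (forall x, sob_fun L w x = sob_fun L u x * sob_fun L v x) ->
    sob_norm w <= sob_norm u * sob_norm v) /\
  (forall (u : sobolev l C) x, normc (sob_fun L u x) <= sob_norm u).

Section Bochner.
Context d (T : measurableType d) (R : realType) (V : normedModType R[i]).
Variable mu : {measure set T -> \bar R}.

(* [s : seq (set T * V)] stands for the simple function sum of [1_A v], for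
   [(A, v)] in [s]. *)
Definition simple_fun (s : seq (set T * V)) (x : T) : V :=
  \sum_(Av <- s) (\1_(Av.1) x)%:C *: Av.2.

Definition simple_integral (s : seq (set T * V)) : V :=
  \sum_(Av <- s) (fine (mu Av.1))%:C *: Av.2.

Definition simple_on (D : set T) (s : seq (set T * V)) : Prop :=
  forall Av, Av \in s ->
    [/\ measurable Av.1, Av.1 `<=` D & (mu Av.1 < +oo)%E].

(* [f] is Bochner integrable on [D], with integral [I]. *)
Definition bochner_integral (D : set T) (f : T -> V) (I : V) : Prop :=
  exists s : nat -> seq (set T * V),
  [/\ forall n, simple_on D (s n),
      {ae mu, forall x, D x -> simple_fun (s n) x @[n --> \oo] --> f x},
      (\int[mu]_(x in D) (complex.Re `|f x - simple_fun (s n) x|)%:E)%E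
        @[n --> \oo] --> 0%E &
      simple_integral (s n) @[n --> \oo] --> I].

End Bochner.

Section Semigroup.
Variables (R : realType) (V : normedModType R[i]).

(* Only the operators [E t] with [t >= 0] are constrained. *)
Record c0_semigroup (E : R -> {linear V -> V}) : Prop := {
  c0_semigroup0 : forall x, E 0 x = x ;
  c0_semigroupD : forall s t, 0 <= s -> 0 <= t ->
    forall x, E (s + t) x = E s (E t x) ;
  c0_semigroup_bounded : forall t, 0 <= t -> continuous (E t) ;
  c0_semigroup_strong : forall x, E t x @[t --> 0^'+] --> x }.

(* The unbounded operator [A] with domain [Dom] (the values of [A] outside
   [Dom] are irrelevant) generates [E]. *)
Definition is_generator (Dom : set V) (A : V -> V)
    (E : R -> {linear V -> V}) : Prop :=
  c0_semigroup E /\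
  forall x y, (h^-1%:C *: (E h x - x) @[h --> 0^'+] --> y) <->
    (Dom x /\ A x = y).

End Semigroup.

Section Nonlinearity.
Variables (R : realType) (L l : R) (C : {posnum R}).
Variables (alpha : nat -> nat -> R[i]) (rho : R[i] -> R[i]).
Local Notation H := (sobolev l C).

Definition degree_ge2 : set (nat * nat) := [set ab | (2 <= ab.1 + ab.2)%N].

Definition has_power_series (Rad : \bar R) : Prop :=
  (forall r : R, 0 <= r -> (r%:E < Rad)%E ->
    (\esum_(ab in degree_ge2)
       (normc (alpha ab.1 ab.2) * r ^+ (ab.1 + ab.2))%:E < +oo)%E) /\
  (forall z : R[i], ((normc z)%:E < Rad)%E ->
    rho z = csum degree_ge2
      (fun ab => alpha ab.1 ab.2 * z ^+ ab.1 * (z^*)%C ^+ ab.2)).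

Definition real_analytic : Prop :=
  forall z0 : R[i], exists (r : R) (c : nat -> nat -> R[i]),
  [/\ 0 < r,
      (\esum_(ab in [set: nat * nat])
         (normc (c ab.1 ab.2) * r ^+ (ab.1 + ab.2))%:E < +oo)%E &
      forall z, normc (z - z0) < r ->
        rho z = csum [set: nat * nat] (fun ab => c ab.1 ab.2 *
          (complex.Re (z - z0))%:C ^+ ab.1 *
          (complex.Im (z - z0))%:C ^+ ab.2)].

Definition resonant_set (a b : nat) (K : int) :
    set ({ffun 'I_a -> int} * {ffun 'I_b -> int}) :=
  [set jk : {ffun 'I_a -> int} * {ffun 'I_b -> int} |
    K ^+ 2 = \sum_m (jk.1 m) ^+ 2 - \sum_m (jk.2 m) ^+ 2 /\
    K = \sum_m jk.1 m - \sum_m jk.2 m].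

Definition resonant_coef (u : H) (K : int) : R[i]^o :=
  csum degree_ge2 (fun ab => alpha ab.1 ab.2 *
    csum (@resonant_set ab.1 ab.2 K) (fun jk =>
      \prod_m (u (jk.1 m) : R[i]) * \prod_m (u (jk.2 m))^*%C)).

(* [insubd] and [xget] default to 0; for [u], [v] in the open ball of radius R
   the defining coefficients, resp. the function [rho \o v], belong to H^l_per
   and the default is not reached. *)
Definition resonant (u : H) : H := insubd 0 (resonant_coef u).

Definition sob_comp (v : H) : H :=
  xget 0 [set g | forall x, sob_fun L g x = rho (sob_fun L v x)].

Definition tau_period : R := L ^+ 2 / (2 * pi).

Variables (T : R) (E B : R -> {linear H -> H}).
Local Notation mu := (@lebesgue_measure R).

Definition mild_solution (u : R -> H) : Prop :=
  forall t, t \in `[0, T] -> exists2 I : H,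
    bochner_integral mu `[0, t] (fun s => B (t - s) (resonant (u s))) I &
    u t = E t (u 0) + I.

Definition extended_mild_solution (u : R -> H) (v w : R * R -> H) : Prop :=
  (forall t, t \in `[0, T] -> v (t, 0) = u t /\ w (t, 0) = 0) /\
  forall t tau, t \in `[0, T] -> tau \in `[0, tau_period] ->
  [/\ exists2 I : H,
        bochner_integral mu `[0, t]
          (fun s => B (t - s) (w (s, tau_period))) I &
        u t = E t (u 0) + (tau_period^-1)%:C *: I,
      v (t, tau) = schrodinger L tau (u t) &
      bochner_integral mu `[0, tau]
        (fun s => schrodinger L (tau - s) (sob_comp (v (t, s))))
        (w (t, tau))].

End Nonlinearity.

(* Main.v *)
(* Through its Fourier coefficients [H = H^l_per(0, L)] becomes a Banach algebra
   of functions: [sob_constant] bounds the l^1 norm of the coefficients, makes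
   [sob_fun] injective, and turns products of trigonometric polynomials into
   Cauchy sequences, so products exist in the limit.  Hence [rho o v] is the
   H-limit of the partial sums of the power series, uniformly on balls of
   radius less than [Rad], and is continuous in [v].

   The integrand [s |-> S_(tau - s) rho (S_s u(t))] is then jointly continuous,
   so [w] exists as a limit of Riemann sums, uniformly on the rectangle.
   At [tau = tau_P] the term of the power series indexed by [(j, k)] carries the
   factor [exp (i s (2 pi / L)^2 (K^2 - |j|^2 + |k|^2))], whose frequency is an
   integer multiple of [2 pi / tau_P].  An equispaced Riemann sum with more
   nodes than this integer annihilates the term unless it is resonant, so that
   [w (t, tau_P) = tau_P N_rho (u(t))].  The two fixed-point equations for [u]
   therefore have proportional integrands. *)
Require Import Defs.
From HB Require Import structures.
From mathcomp Require Import all_boot all_order all_algebra.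
From mathcomp Require Import complex finmap.
From mathcomp Require Import all_classical all_reals all_analysis.
From mathcomp Require Import measurable_realfun ring lra.

Set Implicit Arguments.
Unset Strict Implicit.
Unset Printing Implicit Defensive.

Import Order.TTheory GRing.Theory Num.Theory.
Import ComplexField.Normc.
Import numFieldNormedType.Exports.

Local Open Scope classical_set_scope.
Local Open Scope ring_scope.

(** * Absolutely summable families *)

(** The integrals in both problems are relations: [bochner_integral] admits any sequence of simple
    functions, so a value has to be produced and also shown to be the only one. Riemann sums serve
    both purposes. They are integrals of simple functions that converge uniformly, and
    [bochner_integral_uniform] forces every other approximating sequence to the same limit. No
    integral is ever exchanged with the power series or with the sums over [(j, k)]: a finite piece
    of the series is averaged exactly by a fine enough Riemann sum, and the rest is small in norm,
    uniformly in [s].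

    Infinite sums are treated alike. [csum] is built from suprema over finite sets, so each one is
    replaced by a finite sum with an error controlled by [abs_tail]; the tail of the scalar majorant
    series also controls Sobolev norms.

    Both [sob_comp] and [resonant] carry a default value that must be excluded. For [resonant] the
    decay of the coefficients is never estimated: they are identified, one by one, with those of an
    element already in the space, the Bochner integral divided by [tau_P]. *)

Lemma normc_ge0 (R : rcfType) (z : R[i]) : 0 <= normc z.
Proof. by case: z => x y; exact: sqrtr_ge0. Qed.

Lemma normc_triangle (R : rcfType) (x y : R[i]) :
  normc (x + y) <= normc x + normc y.
Proof. exact: le_normcD. Qed.

Lemma normc_opp (R : rcfType) (x : R[i]) : normc (- x) = normc x.
Proof. exact: normcN. Qed.

Lemma normc_distC (R : rcfType) (x y : R[i]) : normc (x - y) = normc (y - x).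
Proof. by rewrite -normc_opp opprB. Qed.

Lemma normc_conj (R : rcfType) (x : R[i]) : normc (x^*)%C = normc x.
Proof. by case: x => a b /=; rewrite sqrrN. Qed.

Lemma normc_exp (R : rcfType) (x : R[i]) n : normc (x ^+ n) = normc x ^+ n.
Proof.
by elim: n => [|n IH]; rewrite ?expr0 ?normc1// exprS normcM IH [RHS]exprS.
Qed.

Lemma normc_prod (R : rcfType) (I : Type) (s : seq I) (f : I -> R[i]) :
  normc (\prod_(i <- s) f i) = \prod_(i <- s) normc (f i).
Proof. exact: (big_morph _ (@normcM R) (normc1 R)). Qed.

Lemma normc_sum (R : rcfType) (I : Type) (s : seq I) (f : I -> R[i]) :
  normc (\sum_(i <- s) f i) <= \sum_(i <- s) normc (f i).
Proof.
elim: s => [|i s IH]; first by rewrite !big_nil normc0.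
by rewrite !big_cons (le_trans (normc_triangle _ _))// lerD2l.
Qed.

Lemma normc_le_parts (R : rcfType) (z : R[i]) :
  normc z <= `|complex.Re z| + `|complex.Im z|.
Proof.
case: z => x y /=; rewrite -[leRHS]ger0_norm ?addr_ge0// -[leRHS]sqrtr_sqr.
rewrite ler_sqrt ?sqr_ge0// sqrrD !real_normK ?num_real//.
by rewrite lerD2r lerDl mulrn_wge0// mulr_ge0.
Qed.

Lemma norm_Re_le (R : rcfType) (z : R[i]) : `|complex.Re z| <= normc z.
Proof.
case: z => x y /=; rewrite -sqrtr_sqr ler_sqrt ?addr_ge0 ?sqr_ge0//.
by rewrite lerDl sqr_ge0.
Qed.

Lemma norm_Im_le (R : rcfType) (z : R[i]) : `|complex.Im z| <= normc z.
Proof.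
case: z => x y /=; rewrite -sqrtr_sqr ler_sqrt ?addr_ge0 ?sqr_ge0//.
by rewrite lerDr sqr_ge0.
Qed.

Lemma normc_le_eps (R : rcfType) (z : R[i]) (a : R) :
  (forall e, 0 < e -> normc z <= a + e) -> normc z <= a.
Proof. by move=> h; apply/ler_addgt0Pr. Qed.

Lemma normc_small_eq (R : rcfType) (z w : R[i]) :
  (forall e, 0 < e -> normc (z - w) <= e) -> z = w.
Proof.
move=> h; apply/eqP; rewrite -subr_eq0; apply/eqP/eq0_normc/eqP.
by rewrite eq_le normc_ge0 andbT; apply/ler_addgt0Pr => e /h; rewrite add0r.
Qed.

Lemma normc_real (R : rcfType) (x : R) : normc (x%:C)%C = `|x|.
Proof. by rewrite /= expr0n addr0 sqrtr_sqr. Qed.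

Arguments normc : simpl never.

Section AbsolutelySummable.
Variables (R : realType) (I : choiceType) (D : set I).
Implicit Types (A B : {fset I}) (f : I -> R[i]) (g : I -> R).

Definition abs_bounded f (M : R) :=
  forall A, [set` A] `<=` D -> \sum_(i <- A) normc (f i) <= M.

(** Only finite sets disjoint from [A] are tested, so the bound can later be applied to finite sums
    in Sobolev norm without forming an infinite remainder there. *)
Definition abs_tail f A (e : R) :=
  forall B, [set` B] `<=` D -> [disjoint A & B]%fset ->
    \sum_(i <- B) normc (f i) <= e.

Lemma fset_sumD (V : nmodType) A B (h : I -> V) : (A `<=` B)%fset ->
  \sum_(i <- B) h i = \sum_(i <- A) h i + \sum_(i <- (B `\` A)%fset) h i.
Proof.
move=> AB; rewrite (big_fsetID _ (mem A)) /=; congr (_ + _).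
  congr (\sum_(i <- enum_fset _) _); apply/fsetP => i.
  by rewrite !inE /=; apply: andb_idl => /(fsubsetP AB).
by congr (\sum_(i <- enum_fset _) _); apply/fsetP => i; rewrite !inE /= andbC.
Qed.

Lemma fset_sum_le A B g : (forall i, 0 <= g i) -> (A `<=` B)%fset ->
  \sum_(i <- A) g i <= \sum_(i <- B) g i.
Proof. by move=> g0 AB; rewrite (fset_sumD _ AB) lerDl sumr_ge0. Qed.

Lemma esum_fset_le A g : (forall i, 0 <= g i) -> [set` A] `<=` D ->
  ((\sum_(i <- A) g i)%:E <= \esum_(i in D) (g i)%:E)%E.
Proof.
move=> g0 AD; apply: esum_ge; exists [set` A]; first by split.
by rewrite fsbig_finite//= set_fsetK sumEFin.
Qed.

Lemma esum_le_fset g (M : R) :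
  (forall A, [set` A] `<=` D -> \sum_(i <- A) g i <= M) ->
  (\esum_(i in D) (g i)%:E <= M%:E)%E.
Proof.
move=> gM; apply: ge_ereal_sup => _ [F [finF FD] <-].
by rewrite fsbig_finite//= sumEFin lee_fin gM// fset_setK.
Qed.

Lemma fine_esum_le g (M : R) : (forall i, 0 <= g i) ->
  (forall A, [set` A] `<=` D -> \sum_(i <- A) g i <= M) ->
  forall A, [set` A] `<=` D ->
    \sum_(i <- A) g i <= fine (\esum_(i in D) (g i)%:E).
Proof.
move=> g0 gM A AD; rewrite -lee_fin fineK; first exact: esum_fset_le.
rewrite ge0_fin_numE ?esum_ge0//; last by move=> i _; rewrite lee_fin.
by rewrite (le_lt_trans (esum_le_fset gM))// ltry.
Qed.

(** If no finite set came within [e], the supremum defining the sum would be at most itself minus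
    [e], which is absurd because [M] keeps it finite. *)
Lemma fine_esum_approx g (M e : R) : (forall i, 0 <= g i) -> 0 < e ->
  (forall A, [set` A] `<=` D -> \sum_(i <- A) g i <= M) ->
  exists2 A : {fset I}, [set` A] `<=` D &
    fine (\esum_(i in D) (g i)%:E) - e <= \sum_(i <- A) g i.
Proof.
move=> g0 e0 gM; apply: contrapT => h.
have fin : (\esum_(i in D) (g i)%:E)%E \is a fin_num.
  rewrite ge0_fin_numE ?esum_ge0//; last by move=> i _; rewrite lee_fin.
  by rewrite (le_lt_trans (esum_le_fset gM))// ltry.
have : (\esum_(i in D) (g i)%:E <= (fine (\esum_(i in D) (g i)%:E) - e)%:E)%E.
  apply: esum_le_fset => A AD; rewrite leNgt; apply/negP => /ltW AE.
  by apply: h; exists A.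
by rewrite -{1}(fineK fin) lee_fin lerDl oppr_ge0 leNgt e0.
Qed.

(** Positive and negative parts are separate suprema, each nearly attained on a finite set. Both
    parts are monotone in the set, so the union of the two sets and all its finite supersets inside
    [D] are good. *)
Lemma rsum_approx (f : I -> R) (M e : R) : 0 < e ->
  (forall A, [set` A] `<=` D -> \sum_(i <- A) `|f i| <= M) ->
  exists2 A : {fset I}, [set` A] `<=` D &
    forall B, (A `<=` B)%fset -> [set` B] `<=` D ->
    `|rsum D f - \sum_(i <- B) f i| <= e.
Proof.
move=> e0 fM.
pose p i := Num.max (f i) 0; pose q i := Num.max (- f i) 0.
have p0 i : 0 <= p i by rewrite /p le_max lexx orbT.
have q0 i : 0 <= q i by rewrite /q le_max lexx orbT.
have pM A : [set` A] `<=` D -> \sum_(i <- A) p i <= M.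
  move/fM; apply: le_trans; apply: ler_sum => i _.
  by rewrite /p ge_max ler_norm normr_ge0.
have qM A : [set` A] `<=` D -> \sum_(i <- A) q i <= M.
  move/fM; apply: le_trans; apply: ler_sum => i _.
  by rewrite /q ge_max -normrN ler_norm normr_ge0.
have [A AD Ap] := fine_esum_approx p0 e0 pM.
have [B BD Bq] := fine_esum_approx q0 e0 qM.
exists (A `|` B)%fset => [i|X ABX XD].
  by rewrite /= inE => /orP[/AD|/BD].
have AX : (A `<=` X)%fset by rewrite (fsubset_trans _ ABX)// fsubsetUl.
have BX : (B `<=` X)%fset by rewrite (fsubset_trans _ ABX)// fsubsetUr.
have -> : \sum_(i <- X) f i = \sum_(i <- X) p i - \sum_(i <- X) q i.
  rewrite -sumrB; apply: eq_bigr => i _; rewrite /p /q.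
  by case: (lerP (f i) 0) => f0; case: (lerP (- f i) 0) => f0'; lra.
rewrite /rsum -/p -/q.
have := fset_sum_le p0 AX; have := fset_sum_le q0 BX.
have := fine_esum_le p0 pM XD; have := fine_esum_le q0 qM XD.
rewrite ler_norml; rewrite /p /q in Ap Bq *; lra.
Qed.

Lemma csum_approx f (M e : R) : 0 < e -> abs_bounded f M ->
  exists2 A : {fset I}, [set` A] `<=` D &
    forall B, (A `<=` B)%fset -> [set` B] `<=` D ->
    normc (csum D f - \sum_(i <- B) f i) <= e.
Proof.
move=> e0 fM; have e20 : 0 < e / 2 by rewrite divr_gt0.
have [A AD hA] := @rsum_approx (fun i => complex.Re (f i)) M _ e20
  (fun A AD => le_trans (ler_sum _ (fun i _ => norm_Re_le (f i))) (fM A AD)).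
have [B BD hB] := @rsum_approx (fun i => complex.Im (f i)) M _ e20
  (fun A AD => le_trans (ler_sum _ (fun i _ => norm_Im_le (f i))) (fM A AD)).
exists (A `|` B)%fset => [i|X ABX XD].
  by rewrite /= inE => /orP[/AD|/BD].
have AX : (A `<=` X)%fset by rewrite (fsubset_trans _ ABX)// fsubsetUl.
have BX : (B `<=` X)%fset by rewrite (fsubset_trans _ ABX)// fsubsetUr.
apply: le_trans (normc_le_parts _) _.
rewrite [leRHS](splitr e) lerD//.
  have -> : complex.Re (csum D f - \sum_(i <- X) f i) =
      rsum D (fun i => complex.Re (f i)) - \sum_(i <- X) complex.Re (f i).
    by rewrite (raddfB (@complex.Re R : Rcomplex R -> R)) /=
      (raddf_sum (@complex.Re R : Rcomplex R -> R)).
  exact: hA.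
have -> : complex.Im (csum D f - \sum_(i <- X) f i) =
    rsum D (fun i => complex.Im (f i)) - \sum_(i <- X) complex.Im (f i).
  by rewrite (raddfB (@complex.Im R : Rcomplex R -> R)) /=
      (raddf_sum (@complex.Im R : Rcomplex R -> R)).
exact: hB.
Qed.

(** Once the sum over [A] is within [e] of the total, a set disjoint from [A] has at most [e] left
    to contribute. *)
Lemma abs_tail_exists f (M e : R) : 0 < e -> abs_bounded f M ->
  exists2 A : {fset I}, [set` A] `<=` D & abs_tail f A e.
Proof.
move=> e0 fM; have f0 i : 0 <= normc (f i) by exact: normc_ge0.
have [A AD hA] := fine_esum_approx f0 e0 fM; exists A => // B BD AB.
have ABD : [set` (A `|` B)%fset] `<=` D.
  by move=> i /=; rewrite inE => /orP[/AD|/BD].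
have := fine_esum_le f0 fM ABD.
rewrite (fset_sumD _ (fsubsetUl A B)) fsetDUl fsetDv fset0U.
by rewrite (fsetDidPl _ _ _) 1?fdisjoint_sym//; lra.
Qed.

Lemma csum_tail f (M e : R) A : abs_bounded f M -> [set` A] `<=` D ->
  abs_tail f A e -> normc (csum D f - \sum_(i <- A) f i) <= e.
Proof.
move=> fM AD Ae; apply: normc_le_eps => d d0.
have [B BD hB] := csum_approx d0 fM.
have ABD : [set` (A `|` B)%fset] `<=` D.
  by move=> i /=; rewrite inE => /orP[/AD|/BD].
have h1 := hB _ (fsubsetUr A B) ABD.
rewrite -[X in normc (X - _)](subrK (\sum_(i <- (A `|` B)%fset) f i)).
rewrite -addrA; apply: le_trans (normc_triangle _ _) _; rewrite [leRHS]addrC lerD//.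
rewrite (fset_sumD _ (fsubsetUl A B)) addrAC subrr add0r fsetDUl fsetDv fset0U.
apply: le_trans (normc_sum _ _) _; apply: Ae.
  by move=> i /=; rewrite !inE => /andP[_ /BD].
by apply/fdisjointP => i iA; rewrite !inE iA.
Qed.

Lemma csum_fin f A : [set` A] `<=` D ->
  (forall i, D i -> i \notin A -> f i = 0) -> csum D f = \sum_(i <- A) f i.
Proof.
move=> AD f0; apply: normc_small_eq => e e0.
have tail B : [set` B] `<=` D -> [disjoint A & B]%fset ->
    \sum_(i <- B) normc (f i) = 0.
  move=> BD AB; rewrite big_seq big1// => i iB; rewrite f0 ?normc0//.
    exact: BD.
  by apply: contraL iB; exact: (fdisjointP AB).
apply: (@csum_tail _ (\sum_(i <- A) normc (f i))) => // [B BD|B BD AB].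
  rewrite (big_fsetID _ (mem A)) /= [X in _ + X]tail ?addr0.
  - apply: fset_sum_le => [i|]; first exact: normc_ge0.
    by apply/fsubsetP => i; rewrite !inE /= => /andP[].
  - by move=> i /=; rewrite !inE => /andP[/BD].
  - by apply/fdisjointP => i iA; rewrite !inE /= iA andbF.
by rewrite tail// ltW.
Qed.

End AbsolutelySummable.

(** * The Sobolev space *)

Lemma cvg_sum_seq (K : numFieldType) (V : normedModType K) (T I : Type)
    (F : set_system T) (FF : Filter F) (s : seq I) (f : I -> T -> V)
    (y : I -> V) :
  (forall i, f i @ F --> y i) ->
  (fun x => \sum_(i <- s) f i x) @ F --> \sum_(i <- s) y i.
Proof.
move=> fy; elim: s => [|i s IH].
  by under eq_fun do rewrite big_nil; rewrite big_nil; exact: cvg_cst.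
by under eq_fun do rewrite big_cons; rewrite big_cons; exact: cvgD.
Qed.

Arguments coef : simpl never.

Section SobolevSpace.
Variables (R : realType) (l : R) (C : {posnum R}).
Local Notation H := (sobolev l C).
Implicit Types (u v w : H) (A B F : {fset int}) (K J : int).

Lemma sob_norm_ge0 u : 0 <= sob_norm u.
Proof. by rewrite mulr_ge0// sqrtr_ge0. Qed.

Lemma sob_norm0 : sob_norm (0 : H) = 0.
Proof. by rewrite /sob_norm (sob_energy0 l) sqrtr0 mulr0. Qed.

Lemma sob_normN u : sob_norm (- u) = sob_norm u.
Proof. by rewrite -scaleN1r sob_normZ normc_opp normc1 mul1r. Qed.

Lemma sob_distC u v : sob_norm (u - v) = sob_norm (v - u).
Proof. by rewrite -sob_normN opprB. Qed.

Lemma sob_dist_triangle w u v :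
  sob_norm (u - v) <= sob_norm (u - w) + sob_norm (w - v).
Proof. by rewrite (le_trans _ (sob_normD _ _))// addrA subrK. Qed.

Lemma sob_norm_sum (I : Type) (s : seq I) (f : I -> H) :
  sob_norm (\sum_(i <- s) f i) <= \sum_(i <- s) sob_norm (f i).
Proof.
elim: s => [|i s IH]; first by rewrite !big_nil sob_norm0.
by rewrite !big_cons (le_trans (sob_normD _ _))// lerD2l.
Qed.

Lemma sob_normZr (a : R) u : sob_norm (a%:C%C *: u) = `|a| * sob_norm u.
Proof. by rewrite sob_normZ normc_real. Qed.

Lemma coefD u v K : (u + v) K = (u K : R[i]) + v K :> R[i].
Proof. by []. Qed.

Lemma coefB u v K : (u - v) K = (u K : R[i]) - v K :> R[i].
Proof. by []. Qed.

Lemma coefZ (a : R[i]) u K : (a *: u) K = a * (u K : R[i]) :> R[i].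
Proof. by []. Qed.

Lemma coef_sum (I : Type) (s : seq I) (f : I -> H) K :
  (\sum_(i <- s) f i) K = \sum_(i <- s) (f i K : R[i]) :> R[i].
Proof. by elim: s => [|i s IH]; rewrite ?big_nil ?big_cons// coefD IH. Qed.

Lemma coef_inj u v : (forall K, u K = v K) -> u = v.
Proof. by move=> uv; apply: val_inj; apply/funext. Qed.

Let e_ (c : int -> R[i]) K := sob_weight l K * normc (c K) ^+ 2.

Let e_ge0 c K : 0 <= e_ c K.
Proof. by rewrite mulr_ge0 ?sqr_ge0// ltW// sob_weight_gt0. Qed.

Lemma in_sobolev_fset (c : int -> R[i]) (M : R) :
  (forall F, \sum_(K <- F) sob_weight l K * normc (c K) ^+ 2 <= M) ->
  c \in in_sobolev l.
Proof.
move=> cM; rewrite inE /=; apply: (@le_lt_trans _ _ M%:E); last exact: ltry.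
by apply: esum_le_fset => F _; exact: cM.
Qed.

Lemma sob_energy_fset u F :
  \sum_(K <- F) sob_weight l K * normc (u K) ^+ 2 <= (sob_norm u / C%:num) ^+ 2.
Proof.
rewrite /sob_norm mulrAC divff ?gt_eqF// mul1r sqr_sqrtr.
  rewrite -lee_fin fineK ?in_sobolev_fin ?coefP//.
  exact: esum_fset_le (e_ge0 u) _.
by rewrite fine_ge0// sob_energy_ge0.
Qed.

Lemma sob_norm_le u (M : R) : 0 <= M ->
  (forall F, \sum_(K <- F) sob_weight l K * normc (u K) ^+ 2 <=
     (M / C%:num) ^+ 2) ->
  sob_norm u <= M.
Proof.
move=> M0 uM; rewrite /sob_norm mulrC -ler_pdivlMr//.
rewrite -[leRHS]ger0_norm ?divr_ge0// -[leRHS]sqrtr_sqr ler_sqrt ?sqr_ge0//.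
rewrite -lee_fin fineK ?in_sobolev_fin ?coefP//.
by apply: esum_le_fset => F _; exact: uM.
Qed.

Lemma sob_norm_coef_le u v : (forall K, normc (u K) <= normc (v K)) ->
  sob_norm u <= sob_norm v.
Proof.
move=> uv; apply: sob_norm_le => [|F]; first exact: sob_norm_ge0.
apply: le_trans (sob_energy_fset v F); apply: ler_sum => K _.
by rewrite ler_pM2l ?sob_weight_gt0// lerXn2r ?nnegrE ?normc_ge0.
Qed.

Lemma basis_subproof J : (fun K => (K == J)%:R : R[i]^o) \in in_sobolev l.
Proof.
apply: (@in_sobolev_fset _ (sob_weight l J)) => F.
have e0 K : K != J -> sob_weight l K * normc (K == J)%:R ^+ 2 = 0 :> R.
  by move/negbTE => ->; rewrite normc0 expr0n mulr0.
apply: le_trans (fset_sum_le _ (fsubsetU1 J F)) _.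
  by move=> K; exact: (e_ge0 (fun K => (K == J)%:R)).
rewrite (bigD1_seq J)/= ?fset_uniq ?fset1U1// big1 ?addr0//.
by rewrite eqxx normc1 expr1n mulr1.
Qed.

Definition basis J : H := Sobolev C (basis_subproof J).

Lemma basisE J K : basis J K = (K == J)%:R :> R[i].
Proof. by []. Qed.

Definition trunc A u : H := \sum_(K <- A) (u K : R[i]) *: basis K.

Lemma coef_trunc A u K : trunc A u K = (if K \in A then u K else 0) :> R[i].
Proof.
rewrite coef_sum; case: ifPn => KA.
  rewrite (bigD1_seq K) ?fset_uniq//= coefZ basisE eqxx mulr1 big1 ?addr0// => J JK.
  by rewrite coefZ basisE eq_sym (negbTE JK) mulr0.
rewrite big_seq big1// => J JA; rewrite coefZ basisE.
by case: eqP => [KJ|]; rewrite ?mulr0//; rewrite KJ JA in KA.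
Qed.

Lemma trunc_norm A u : sob_norm (trunc A u) <= sob_norm u.
Proof.
apply: sob_norm_coef_le => K; rewrite coef_trunc; case: ifP => // _.
by rewrite normc0 normc_ge0.
Qed.

Lemma trunc_dense u (e : R) : 0 < e ->
  exists A, forall B, (A `<=` B)%fset -> sob_norm (u - trunc B u) <= e.
Proof.
move=> e0; have e20 : 0 < (e / C%:num) ^+ 2 by rewrite exprn_gt0// divr_gt0.
have eM F : [set` F] `<=` [set: int] ->
    \sum_(K <- F) e_ u K <= (sob_norm u / C%:num) ^+ 2.
  by move=> _; exact: sob_energy_fset.
have [A _ hA] := fine_esum_approx (e_ge0 u) e20 eM.
exists A => B AB; apply: sob_norm_le => [|F]; first exact: ltW.
have E K : e_ (u - trunc B u) K = if K \in B then 0 else e_ u K.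
  rewrite /e_ coefB coef_trunc; case: ifP => _; last by rewrite subr0.
  by rewrite subrr normc0 expr0n mulr0.
rewrite -/(e_ (u - trunc B u)) (big_fsetID _ (mem B)) /=.
rewrite big_seq big1 ?add0r; last first.
  by move=> K; rewrite inE /= => /andP[_ KB]; rewrite -/(e_ (u - trunc B u) K) E KB.
have sB : [set` (B `|` F)%fset] `<=` [set: int] by [].
(* The energy over [B] and over what [F] adds to it stays below the total, while [A], hence [B],
   already accounts for all but the square of [e / C]. *)
have := fine_esum_le (e_ge0 u) eM sB.
have := fset_sum_le (e_ge0 u) AB.
rewrite (fset_sumD _ (fsubsetUl B F)).
suff -> : \sum_(K <- [fset x in F | x \notin B]%fset)
    sob_weight l K * normc ((u - trunc B u) K) ^+ 2 =
    \sum_(K <- ((B `|` F) `\` B)%fset) e_ u K by lra.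
rewrite fsetDUl fsetDv fset0U (_ : [fset x in F | x \notin B]%fset = (F `\` B)%fset).
  rewrite big_seq [RHS]big_seq; apply: eq_bigr => K; rewrite inE => /andP[KB _].
  by rewrite -/(e_ (u - trunc B u) K) E (negbTE KB).
by apply/fsetP => K; rewrite !inE andbC.
Qed.

(** The constant depends on [K], which is enough for coefficientwise limits; the uniform bound
    [normc_coef] comes later from [sob_constant]. *)
Lemma sob_coef_bound K : exists2 c : R, 0 < c & forall u, normc (u K) <= c * sob_norm u.
Proof.
have w0 := sob_weight_gt0 l K; exists (C%:num * Num.sqrt (sob_weight l K))^-1.
  by rewrite invr_gt0 mulr_gt0// sqrtr_gt0.
move=> u; rewrite mulrC ler_pdivlMr ?mulr_gt0 ?sqrtr_gt0//.
rewrite mulrCA -ler_pdivlMl// mulrC [leRHS]mulrC.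
have := sob_energy_fset u [fset K]%fset; rewrite big_seq_fset1 => h.
have nu : 0 <= sob_norm u / C%:num by rewrite divr_ge0// sob_norm_ge0.
rewrite -ler_sqr ?nnegrE ?mulr_ge0 ?sqrtr_ge0 ?normc_ge0//.
by rewrite exprMn sqr_sqrtr// ltW.
Qed.

(* Coefficientwise limits and Fatou's lemma give completeness. *)
Lemma sob_complete (x : nat -> H) (eps : nat -> R) :
  eps @ \oo --> 0 ->
  (forall n m, (n <= m)%N -> sob_norm (x n - x m) <= eps n) ->
  exists y, forall n, sob_norm (x n - y) <= eps n.
Proof.
move=> eps0 xC.
have eps_ge0 n : 0 <= eps n.
  by apply: le_trans (xC n n (leqnn n)); exact: sob_norm_ge0.
(* Here [p] stands for the real and the imaginary part in turn, so that completeness of [R] can be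
   applied to each. *)
have cvgc K (p : R[i] -> R) : (forall a b, `|p a - p b| <= normc (a - b)) ->
    cvg ((fun n => p (x n K)) @ \oo).
  move=> p1; have [c c0 hc] := sob_coef_bound K.
  apply: cauchy_cvg; apply/cauchy_exP => e e0.
  have /cvgrPdist_lt/(_ (e / c)) := eps0.
  rewrite divr_gt0// => /(_ isT)[n _ /= hn].
  exists (p (x n K)); exists n => //= m nm; rewrite /ball /=.
  apply: le_lt_trans (p1 _ _) _; rewrite -coefB.
  apply: le_lt_trans (hc _) _; rewrite mulrC -ltr_pdivlMr//.
  apply: le_lt_trans (xC n m nm) _; have := hn n (leqnn n).
  by rewrite sub0r normrN ger0_norm.
pose re K := lim ((fun n => complex.Re (x n K)) @ \oo).
pose im K := lim ((fun n => complex.Im (x n K)) @ \oo).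
pose y K : R[i]^o := Complex (re K) (im K).
have ReB (a b : R[i]) : complex.Re (a - b) = complex.Re a - complex.Re b.
  by case: a b => ? ? [].
have ImB (a b : R[i]) : complex.Im (a - b) = complex.Im a - complex.Im b.
  by case: a b => ? ? [].
have cre K : (fun n => complex.Re (x n K)) @ \oo --> re K.
  by apply: (cvgc K (@complex.Re R)) => a b; rewrite -ReB norm_Re_le.
have cim K : (fun n => complex.Im (x n K)) @ \oo --> im K.
  by apply: (cvgc K (@complex.Im R)) => a b; rewrite -ImB norm_Im_le.
have sqE (z : R[i]) : normc z ^+ 2 = complex.Re z ^+ 2 + complex.Im z ^+ 2.
  by case: z => a b; rewrite /normc sqr_sqrtr// addr_ge0 ?sqr_ge0.
have fatou n F : \sum_(K <- F) sob_weight l K * normc (x n K - y K) ^+ 2 <=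
    (eps n / C%:num) ^+ 2.
  have cF : (fun m => \sum_(K <- F) sob_weight l K * normc (x n K - x m K) ^+ 2)
      @ \oo --> \sum_(K <- F) sob_weight l K * normc (x n K - y K) ^+ 2.
    apply: cvg_sum_seq => K; apply: cvgMl_tmp; rewrite sqE.
    under eq_fun do rewrite sqE !ReB !ImB !expr2.
    rewrite !ReB !ImB !expr2.
    have c1 : (fun m => complex.Re (x n K) - complex.Re (x m K)) @ \oo -->
        complex.Re (x n K) - re K by apply: cvgB => //; exact: cvg_cst.
    have c2 : (fun m => complex.Im (x n K) - complex.Im (x m K)) @ \oo -->
        complex.Im (x n K) - im K by apply: cvgB => //; exact: cvg_cst.
    by apply: cvgD; apply: cvgM.
  apply: (cvgr_to_le cF); exists n => // m /= nm.
  apply: le_trans (sob_energy_fset (x n - x m) F) _.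
  by rewrite lerXn2r ?nnegrE ?divr_ge0 ?sob_norm_ge0// ler_pM2r ?invr_gt0// xC.
(* Fatou at index 0 gives [x 0 - y] finite energy, and [y] is the difference of [x 0] and that
   element. *)
have yP : y \in in_sobolev l.
  have : (fun K => coef (x 0%N) K - y K) \in in_sobolev l.
    by apply: (@in_sobolev_fset _ ((eps 0%N / C%:num) ^+ 2)) => F; exact: fatou.
  move=> hz; have -> : y = coef (x 0%N - Sobolev C hz).
    apply/funext => K; change (y K = coef (x 0%N) K - (coef (x 0%N) K - y K)).
    by rewrite opprB addrC subrK.
  exact: coefP.
by exists (Sobolev C yP) => n; apply: sob_norm_le => // F; exact: fatou.
Qed.

End SobolevSpace.

(** * Fourier series and products *)

Section Expi.
Variable R : realType.
Implicit Types x y : R.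

Lemma expi0 : expi (0 : R) = 1.
Proof. by rewrite /expi cos0 sin0. Qed.

Lemma expiD x y : expi (x + y) = expi x * expi y.
Proof.
rewrite /expi cosD sinD; apply/eqP; rewrite eq_complex /=.
by rewrite eqxx addrC mulrC [X in _ + X]mulrC mulrC eqxx.
Qed.

Lemma expiN x : expi (- x) = (expi x)^*%C.
Proof. by rewrite /expi cosN sinN. Qed.

Lemma expi_natmul n x : expi (n%:R * x) = expi x ^+ n.
Proof.
elim: n => [|n IH]; first by rewrite mul0r expi0 expr0.
by rewrite -natr1 mulrDl mul1r expiD IH exprSr.
Qed.

Lemma expi_2piz (m : int) : expi (2 * pi * m%:~R : R) = 1.
Proof.
have h n : expi (2 * pi * n%:R : R) = 1.
  rewrite mulrC expi_natmul (_ : expi (2 * pi) = 1) ?expr1n//.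
  by rewrite mulr_natl /expi cos2pi sin2pi.
case: m => n; first exact: h.
by rewrite NegzE mulrNz mulrN expiN h conjc1.
Qed.

(** By the half-angle formula, [cos x = 1] forces [sin (x / 2) = 0], whereas the sine is positive
    between 0 and [pi]. *)
Lemma expi_neq1 x : 0 < x < 2 * pi -> expi x != 1.
Proof.
move=> /andP[x0 x2]; apply/eqP => -[c1 _].
have yP : 0 < x / 2 < pi.
  by rewrite divr_gt0//= ltr_pdivrMr// mulrC.
have := sin_gt0_pi yP; have := cosD (x / 2) (x / 2).
rewrite -splitr c1 => h; have := cos2Dsin2 (x / 2); nra.
Qed.

End Expi.

Section FourierSeries.
Variables (R : realType) (L l : R) (C : {posnum R}).
Hypothesis C_large : sob_constant L l C.
Local Notation H := (sobolev l C).
Local Notation sf := (@sob_fun R L l C).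
Implicit Types (u v w : H) (A B : {fset int}) (K J : int).

Lemma sob_fun_fin A u x : (forall K, K \notin A -> u K = 0) ->
  sf u x = \sum_(K <- A) (u K : R[i]) * expi (2 * pi * K%:~R * x / L).
Proof. by move=> uA; apply: csum_fin => // K _ /uA ->; rewrite mul0r. Qed.

(* At [x = 0] the sup-norm bound for the element with coefficients [`|u K|]
   is an l^1 bound on the coefficients of [u]. *)
Lemma sob_l1 u A : \sum_(K <- A) normc (u K) <= sob_norm u.
Proof.
pose v : H := \sum_(K <- A) (normc (u K))%:C%C *: basis l C K.
have vE K : v K = (if K \in A then (normc (u K))%:C%C else 0) :> R[i].
  rewrite /v coef_sum; case: ifPn => KA.
    rewrite (bigD1_seq K) ?fset_uniq//= coefZ basisE eqxx mulr1 big1 ?addr0//.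
    by move=> J JK; rewrite coefZ basisE eq_sym (negbTE JK) mulr0.
  rewrite big_seq big1// => J JA; rewrite coefZ basisE.
  by case: eqP => [KJ|]; rewrite ?mulr0//; rewrite KJ JA in KA.
have vu : sob_norm v <= sob_norm u.
  apply: sob_norm_coef_le => K; rewrite vE; case: ifP => _.
    by rewrite normc_real ger0_norm ?normc_ge0.
  by rewrite normc0 normc_ge0.
apply: le_trans vu; apply: le_trans (C_large.2 v 0).
rewrite (@sob_fun_fin A); last by move=> K; rewrite vE => /negbTE ->.
under [X in _ <= normc X]eq_bigr do rewrite mulr0 mul0r expi0 mulr1.
rewrite (_ : \sum_(K <- A) (v K : R[i]) = (\sum_(K <- A) normc (u K))%:C%C).
  by rewrite normc_real ler_norm.
rewrite rmorph_sum /= big_seq [RHS]big_seq; apply: eq_bigr => K KA.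
by rewrite vE KA.
Qed.

Lemma normc_coef u K : normc (u K) <= sob_norm u.
Proof. by have := sob_l1 u [fset K]%fset; rewrite big_seq_fset1. Qed.

Lemma sob_term_norm u K x :
  normc ((u K : R[i]) * expi (2 * pi * K%:~R * x / L)) = normc (u K).
Proof. by rewrite normcM normc_expi mulr1. Qed.

Lemma sob_abs_bounded u x :
  abs_bounded [set: int] (fun K => (u K : R[i]) * expi (2 * pi * K%:~R * x / L))
    (sob_norm u).
Proof.
move=> A _; apply: le_trans (sob_l1 u A).
by apply: ler_sum => K _; rewrite sob_term_norm.
Qed.

Lemma sob_fun_approx u x (e : R) : 0 < e ->
  exists A, forall B, (A `<=` B)%fset -> normc (sf u x -
    \sum_(K <- B) (u K : R[i]) * expi (2 * pi * K%:~R * x / L)) <= e.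
Proof.
move=> e0; have [A _ hA] := csum_approx e0 (@sob_abs_bounded u x).
by exists A => B AB; exact: hA.
Qed.

Lemma sob_funD u v x : sf (u + v) x = sf u x + sf v x.
Proof.
apply: normc_small_eq => e e0; have e30 : 0 < e / 3 by rewrite divr_gt0.
have [A1 h1] := sob_fun_approx (u + v) x e30.
have [A2 h2] := sob_fun_approx u x e30.
have [A3 h3] := sob_fun_approx v x e30.
pose B := (A1 `|` A2 `|` A3)%fset.
have {}h1 := h1 B (fsubset_trans (fsubsetUl A1 A2) (fsubsetUl _ _)).
have {}h2 := h2 B (fsubset_trans (fsubsetUr A1 A2) (fsubsetUl _ _)).
have {}h3 := h3 B (fsubsetUr _ _).
move: h1; under eq_bigr do rewrite coefD mulrDl.
rewrite big_split /=.
set s2 := \sum_(K <- B) _ in h2 *; set s3 := \sum_(K <- B) _ in h3 *.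
set a := sf (u + v) x; set b := sf u x in h2 *; set c := sf v x in h3 *.
move=> h1; have -> : a - (b + c) = (a - (s2 + s3)) + - ((b - s2) + (c - s3)).
  ring.
apply: le_trans (normc_triangle _ _) _; rewrite normc_opp.
have := normc_triangle (b - s2) (c - s3); lra.
Qed.

Lemma sob_funZ (a : R[i]) u x : sf (a *: u) x = a * sf u x.
Proof.
apply: normc_small_eq => e e0.
(* Adding 1 to [normc a] keeps the denominator positive when [a = 0]. *)
have d0 : 0 < e / 2 / (1 + normc a).
  by rewrite !divr_gt0// ltr_pwDl// normc_ge0.
have e20 : 0 < e / 2 by rewrite divr_gt0.
have [A1 h1] := sob_fun_approx (a *: u) x e20.
have [A2 h2] := sob_fun_approx u x d0.
have {}h1 := h1 _ (fsubsetUl A1 A2); have {}h2 := h2 _ (fsubsetUr A1 A2).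
move: h1; under eq_bigr do rewrite coefZ -mulrA.
rewrite -mulr_sumr; set s := \sum_(_ <- _) _ in h2 *.
rewrite (_ : sf _ x - a * sf u x =
  (sf (a *: u) x - a * s) + - (a * (sf u x - s))); last by ring.
move=> h1; apply: le_trans (normc_triangle _ _) _; rewrite normc_opp normcM.
have := ler_wpM2l (normc_ge0 a) h2.
have : normc a * (e / 2 / (1 + normc a)) <= e / 2.
  rewrite mulrA ler_pdivrMr; last by rewrite ltr_pwDl// normc_ge0.
  by rewrite mulrC ler_pM2l// lerDr.
lra.
Qed.

Lemma sob_funN u x : sf (- u) x = - sf u x.
Proof. by rewrite -scaleN1r sob_funZ mulN1r. Qed.

Lemma sob_funB u v x : sf (u - v) x = sf u x - sf v x.
Proof. by rewrite sob_funD sob_funN. Qed.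

Lemma sob_fun0 x : sf 0 x = 0.
Proof. by rewrite -(subrr (0 : H)) sob_funB subrr. Qed.

Lemma sob_fun_sum (I : Type) (s : seq I) (f : I -> H) x :
  sf (\sum_(i <- s) f i) x = \sum_(i <- s) sf (f i) x.
Proof.
elim: s => [|i s IH]; first by rewrite !big_nil sob_fun0.
by rewrite !big_cons sob_funD IH.
Qed.

Lemma sob_fun_basis K x : sf (basis l C K) x = expi (2 * pi * K%:~R * x / L).
Proof.
rewrite (@sob_fun_fin [fset K]%fset) ?big_seq_fset1 ?basisE ?eqxx ?mul1r//.
by move=> J; rewrite inE basisE => /negbTE ->.
Qed.

(* The product rule applied to [u - v = 0 * 0] bounds [u - v] by [0]. *)
Lemma sob_fun_inj u v : (forall x, sf u x = sf v x) -> u = v.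
Proof.
move=> uv; apply/eqP; rewrite -subr_eq0; apply/eqP/sob_norm_eq0.
apply/eqP; rewrite eq_le sob_norm_ge0 andbT -(mulr0 (sob_norm (0 : H))).
rewrite -[X in _ * X](sob_norm0 l C); apply: C_large.1 => x.
by rewrite sob_funB uv subrr sob_fun0 mulr0.
Qed.

(** Norm bounds are attached to functions rather than elements, so products, powers and conjugates
    can be estimated before the element is named; injectivity of [sob_fun] carries the bound to any
    representing element ([sob_boundedP]). *)
Definition sob_bounded (f : R -> R[i]) (r : R) :=
  exists2 w, (forall x, sf w x = f x) & sob_norm w <= r.

Lemma sob_boundedP f r w : (forall x, sf w x = f x) ->
  sob_bounded f r -> sob_norm w <= r.
Proof.
move=> wf [v vf vr]; rewrite (_ : w = v)//; apply: sob_fun_inj => x.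
by rewrite wf vf.
Qed.

Lemma sob_bounded_le f r q : r <= q -> sob_bounded f r -> sob_bounded f q.
Proof. by move=> rq [w wf wr]; exists w => //; exact: le_trans rq. Qed.

Lemma sob_bounded_ext g f r : (forall x, f x = g x) ->
  sob_bounded f r -> sob_bounded g r.
Proof. by move=> fg [w wf wr]; exists w => // x; rewrite wf. Qed.

Lemma sob_bounded_ge0 f r : sob_bounded f r -> 0 <= r.
Proof. by case=> w _; apply: le_trans; exact: sob_norm_ge0. Qed.

Lemma sob_boundedD f g r q : sob_bounded f r -> sob_bounded g q ->
  sob_bounded (fun x => f x + g x) (r + q).
Proof.
move=> [u uf ur] [v vg vq]; exists (u + v) => [x|].
  by rewrite sob_funD uf vg.
exact: le_trans (sob_normD _ _) (lerD ur vq).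
Qed.

Lemma sob_boundedZ (a : R[i]) f r : sob_bounded f r ->
  sob_bounded (fun x => a * f x) (normc a * r).
Proof.
move=> [u uf ur]; exists (a *: u) => [x|]; first by rewrite sob_funZ uf.
by rewrite sob_normZ ler_wpM2l// normc_ge0.
Qed.

Lemma sob_boundedB f g r q : sob_bounded f r -> sob_bounded g q ->
  sob_bounded (fun x => f x - g x) (r + q).
Proof.
move=> [u uf ur] [v vg vq]; exists (u - v) => [x|].
  by rewrite sob_funB uf vg.
by rewrite (le_trans (sob_normD _ _))// sob_normN lerD.
Qed.

Lemma sob_bounded_sum (I : eqType) (s : seq I) (f : I -> R -> R[i])
    (r : I -> R) :
  (forall i, i \in s -> sob_bounded (f i) (r i)) ->
  sob_bounded (fun x => \sum_(i <- s) f i x) (\sum_(i <- s) r i).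
Proof.
elim: s => [_|i s IH fr].
  by exists 0 => [x|]; rewrite big_nil ?sob_fun0// sob_norm0.
apply: (@sob_bounded_ext (fun x => \sum_(i <- i :: s) f i x)
  (fun x => f i x + \sum_(i <- s) f i x)) => [x|]; first by rewrite big_cons.
rewrite big_cons; apply: sob_boundedD; first by apply: fr; rewrite mem_head.
by apply: IH => k ks; apply: fr; rewrite inE ks orbT.
Qed.

(** Completeness supplies the limit, and since the norm dominates the sup norm, its function is the
    pointwise limit [f]. *)
Lemma sob_limit (w : nat -> H) (eps : nat -> R) (f : R -> R[i]) :
  eps @ \oo --> 0 ->
  (forall n m, (n <= m)%N -> sob_norm (w n - w m) <= eps n) ->
  (forall x n, normc (sf (w n) x - f x) <= eps n) ->
  exists y, (forall x, sf y x = f x) /\ forall n, sob_norm (w n - y) <= eps n.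
Proof.
move=> eps0 wC wf; have [y yw] := sob_complete eps0 wC; exists y; split => // x.
apply: normc_small_eq => e e0; have e20 : 0 < e / 2 by rewrite divr_gt0.
have /cvgrPdist_lt/(_ _ e20)[n _ /(_ n (leqnn n))] := eps0.
rewrite sub0r normrN => /ltW h.
have {}h := le_trans (ler_norm _) h.
rewrite (_ : sf y x - f x = - (sf (w n) x - sf y x) + (sf (w n) x - f x));
  last by ring.
apply: le_trans (normc_triangle _ _) _; rewrite normc_opp -sob_funB.
have := C_large.2 (w n - y) x; have := yw n; have := wf x n; lra.
Qed.

(** Existence of the product must be proved: [sob_constant] bounds the norm of an element that
    represents a product but does not provide one. *)
Definition mulable u v := exists w, forall x, sf w x = sf u x * sf v x.

Lemma mulableC u v : mulable u v -> mulable v u.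
Proof. by case=> w h; exists w => x; rewrite mulrC. Qed.

Lemma mulable_basis J K : mulable (basis l C J) (basis l C K).
Proof.
exists (basis l C (J + K)) => x; rewrite !sob_fun_basis -expiD.
by rewrite rmorphD /= mulrDr !mulrDl.
Qed.

Lemma mulable_sum (I : Type) (s : seq I) (f : I -> H) v :
  (forall i, mulable (f i) v) -> mulable (\sum_(i <- s) f i) v.
Proof.
move=> fv; elim: s => [|i s [w hw]].
  by exists 0 => x; rewrite big_nil sob_fun0 mul0r.
by have [w' hw'] := fv i; exists (w' + w) => x;
  rewrite big_cons !sob_funD hw hw' mulrDl.
Qed.

Lemma mulableZ (a : R[i]) u v : mulable u v -> mulable (a *: u) v.
Proof. by case=> w h; exists (a *: w) => x; rewrite !sob_funZ h mulrA. Qed.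

(** Submultiplicativity applied to differences of truncations makes the products Cauchy; the factor
    2 in [eps] collects two truncation errors. *)
Lemma mulable_trunc u v : (forall A, mulable (trunc A u) v) -> mulable u v.
Proof.
move=> h; pose eps n : R := 2 * n.+1%:R^-1 * (1 + sob_norm v).
have [A hA] : {A : nat -> {fset int} & forall n,
    sob_norm (u - trunc (A n) u) <= n.+1%:R^-1}.
  apply: (@choice _ _ (fun n A => sob_norm (u - trunc A u) <= n.+1%:R^-1)) => n.
  have e0 : 0 < n.+1%:R^-1 :> R by rewrite invr_gt0.
  by have [A hA] := trunc_dense u e0; exists A; exact: hA.
have [w hw] := choice (fun n => h (A n)).
have nv0 := sob_norm_ge0 v.
have nn n m : (n <= m)%N -> m.+1%:R^-1 <= n.+1%:R^-1 :> R.
  by move=> nm; rewrite lef_pV2 ?posrE// ler_nat.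
have [||x n|y [hy _]] := @sob_limit w eps (fun x => sf u x * sf v x).
- have : (fun n => 2 * n.+1%:R^-1 * (1 + sob_norm v)) @ \oo -->
      2 * 0 * (1 + sob_norm v).
    by apply: cvgMr_tmp; apply: cvgMl_tmp; exact: cvg_harmonic.
  by rewrite mulr0 mul0r.
- move=> n m nm; rewrite /eps; apply: le_trans 
    (C_large.1 (trunc (A n) u - trunc (A m) u) v _ _) _.
    by move=> x; rewrite !sob_funB !hw mulrBl.
  apply: ler_pM => //; first exact: sob_norm_ge0; last by rewrite lerDr.
  apply: le_trans (sob_dist_triangle u _ _) _.
  rewrite [sob_norm (trunc (A n) u - u)]sob_distC.
  move: (hA n) (hA m) (nn _ _ nm); set a := n.+1%:R^-1; set b := m.+1%:R^-1.
  lra.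
- rewrite hw -mulrBl -sob_funB normcM /eps.
  apply: ler_pM; rewrite ?normc_ge0//.
    apply: le_trans (C_large.2 _ _) _; rewrite sob_distC.
    apply: le_trans (hA n) _; rewrite ler_peMl ?invr_ge0 ?ler1n //.
  by apply: le_trans (C_large.2 _ _) _; rewrite lerDr.
by exists y.
Qed.

(** Truncating one factor, swapping, and truncating the other leaves products of two exponentials,
    which are again exponentials. *)
Lemma sob_mulable u v : mulable u v.
Proof.
apply: mulable_trunc => A; apply: mulable_sum => K; apply: mulableZ.
apply: mulableC; apply: mulable_trunc => B; apply: mulable_sum => J.
by apply: mulableZ; exact: mulable_basis.
Qed.

Lemma sob_boundedM f g r q : sob_bounded f r -> sob_bounded g q ->
  sob_bounded (fun x => f x * g x) (r * q).
Proof.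
move=> [u uf ur] [v vg vq]; have [w hw] := sob_mulable u v.
exists w => [x|]; first by rewrite hw uf vg.
apply: le_trans (C_large.1 u v w hw) _.
by apply: ler_pM => //; exact: sob_norm_ge0.
Qed.

(** Exponents start at 1: the constant function 1 has norm [C], which need not be at most [r ^+ 0].
    For the same reason monomials are split below according to which exponent vanishes. *)
Lemma sob_boundedX f r n : sob_bounded f r ->
  sob_bounded (fun x => f x ^+ n.+1) (r ^+ n.+1).
Proof.
move=> fr; elim: n => [|n IH]; first by rewrite expr1.
rewrite exprS; apply: sob_bounded_ext (sob_boundedM fr IH) => x.
by rewrite [RHS]exprS.
Qed.

(** Conjugation turns the exponential of index [K] into that of index [- K], hence the reflection;
    the weights are even, so the energy is unchanged. *)
Lemma conj_subproof u : (fun K => (u (- K) : R[i])^*%C : R[i]^o) \in in_sobolev l.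
Proof.
apply: (@in_sobolev_fset _ _ _ ((sob_norm u / C%:num) ^+ 2)) => F.
apply: le_trans (sob_energy_fset u [fset - K | K in F]%fset).
rewrite big_imfset /=; last by move=> J K _ _ /oppr_inj.
apply: ler_sum => K _; rewrite normc_conj /sob_weight mulrNz sqrrN.
exact: lexx.
Qed.

Definition sob_conj u : H := Sobolev C (conj_subproof u).

Lemma sob_conjE u K : sob_conj u K = (u (- K) : R[i])^*%C :> R[i].
Proof. by []. Qed.

Lemma sob_conj_norm u : sob_norm (sob_conj u) <= sob_norm u.
Proof.
apply: sob_norm_le => [|F]; first exact: sob_norm_ge0.
apply: le_trans (sob_energy_fset u [fset - K | K in F]%fset).
rewrite big_imfset /=; last by move=> J K _ _ /oppr_inj.
by apply: ler_sum => K _; rewrite sob_conjE normc_conj /sob_weight mulrNz sqrrN.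
Qed.

Lemma sob_fun_conj u x : sf (sob_conj u) x = (sf u x)^*%C.
Proof.
apply: normc_small_eq => e e0; have e20 : 0 < e / 2 by rewrite divr_gt0.
have [A1 h1] := sob_fun_approx (sob_conj u) x e20.
have [A2 h2] := sob_fun_approx u x e20.
(* Summing [u] over [B] amounts to summing its conjugate over [- B], which has to contain [A1]. *)
pose B := (A2 `|` [fset - K | K in A1])%fset.
have {}h2 := h2 B (fsubsetUl _ _).
have {}h1 : normc (sf (sob_conj u) x -
    (\sum_(K <- B) (u K : R[i]) * expi (2 * pi * K%:~R * x / L))^*%C) <= e / 2.
  have := h1 [fset - K | K in B]%fset.
  rewrite big_imfset /=; last by move=> J K _ _ /oppr_inj.
  move=> h3; rewrite (le_trans _ (h3 _))//.
    rewrite rmorph_sum /=; under [X in _ <= normc (_ - X)]eq_bigr => K _.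
      rewrite sob_conjE opprK rmorphN /= mulrN mulNr mulNr expiN -rmorphM; over.
    by [].
  apply/fsubsetP => K KA; apply/imfsetP; exists (- K); rewrite ?opprK//=.
  by rewrite inE; apply/orP; right; apply/imfsetP; exists K.
set s := \sum_(K <- B) _ in h1 h2 *.
rewrite (_ : _ - _ = (sf (sob_conj u) x - s^*%C) + (s^*%C - (sf u x)^*%C));
  last by ring.
apply: le_trans (normc_triangle _ _) _.
by rewrite -rmorphB normc_conj [normc (s - _)]normc_distC [leRHS]splitr lerD.
Qed.

Lemma sob_bounded_conj f r : sob_bounded f r ->
  sob_bounded (fun x => (f x)^*%C) r.
Proof.
move=> [u uf ur]; exists (sob_conj u) => [x|]; first by rewrite sob_fun_conj uf.
exact: le_trans (sob_conj_norm u) ur.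
Qed.

End FourierSeries.

(** * Superposition with a power series *)

(** The norm of the module is [R[i]]-valued, but a positive complex number is real, so real radii
    describe the same topology. *)
Lemma sob_cvgP (R : realType) (l : R) (C : {posnum R}) (T : Type)
    (F : set_system T) (FF : Filter F) (f : T -> sobolev l C)
    (y : sobolev l C) :
  f @ F --> y <->
  forall e : R, 0 < e -> \forall x \near F, sob_norm (y - f x) < e.
Proof.
split=> [/cvgrPdist_lt h e e0|h].
  have /h : 0 < e%:C%C by rewrite ltcR.
  by apply: filterS => x; rewrite sob_normE ltcR.
apply/cvgrPdist_lt => e; rewrite ltcE /= => /andP[/eqP e1 /h].
by apply: filterS => x; rewrite sob_normE ltcE /= -e1 eqxx.
Qed.

Section Composition.
Variables (R : realType) (L l : R) (C : {posnum R}).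
Hypothesis C_large : sob_constant L l C.
Variables (alpha : nat -> nat -> R[i]) (rho : R[i] -> R[i]) (Rad : \bar R).
Hypothesis rho_series : has_power_series alpha rho Rad.
Local Notation H := (sobolev l C).
Local Notation sf := (@sob_fun R L l C).
Local Notation bnd := (@sob_bounded R L l C).
Implicit Types (u v w : H) (A B : {fset nat * nat}) (phi psi : R[i] -> R[i]).

(** The bound [M] is carried along with the Lipschitz constant because the product rule needs the
    size of both factors. *)
Definition lipschitz_op (r : R) phi := exists M c : R, 0 <= c /\
  forall f g d, bnd f r -> bnd g r -> bnd (fun x => f x - g x) d ->
    bnd (fun x => phi (f x)) M /\
    bnd (fun x => phi (f x) - phi (g x)) (c * d).

Lemma lipschitz_id r : lipschitz_op r id.
Proof. by exists r, 1; split => // f g d fr gr fg; rewrite mul1r. Qed.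

Lemma lipschitz_conj r : lipschitz_op r (fun z => z^*%C).
Proof.
exists r, 1; split => // f g d fr gr fg; split.
  exact: (sob_bounded_conj C_large).
rewrite mul1r; apply: sob_bounded_ext (sob_bounded_conj C_large fg) => x.
exact: rmorphB.
Qed.

Lemma lipschitzM r phi psi : lipschitz_op r phi -> lipschitz_op r psi ->
  lipschitz_op r (fun z => phi z * psi z).
Proof.
move=> [M1 [c1 [c10 h1]]] [M2 [c2 [c20 h2]]].
exists (M1 * M2), (`|M1| * c2 + c1 * `|M2|); split.
  by rewrite addr_ge0// mulr_ge0.
move=> f g d fr gr fg; have [p1 d1] := h1 f g d fr gr fg.
have [p2 d2] := h2 f g d fr gr fg.
(* The definition bounds the operator only at the first function of a pair; the pair [(g, g)] at
   distance 0 gives the bound at [g]. *)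
have gg : bnd (fun x => g x - g x) 0.
  by exists 0 => [x|]; rewrite ?sob_norm0// (sob_fun0 C_large) subrr.
have [q2 _] := h2 g g 0 gr gr gg.
split; first exact: (sob_boundedM C_large).
have e1 := sob_boundedM C_large p1 d2; have e2 := sob_boundedM C_large d1 q2.
have M10 := sob_bounded_ge0 p1; have M20 := sob_bounded_ge0 q2.
rewrite !ger0_norm//.
rewrite (_ : _ * d = M1 * (c2 * d) + c1 * d * M2); last by ring.
by apply: sob_bounded_ext (sob_boundedD C_large e1 e2) => x; ring.
Qed.

Lemma lipschitzZ r a phi : lipschitz_op r phi ->
  lipschitz_op r (fun z => a * phi z).
Proof.
move=> [M [c [c0 h]]]; exists (normc a * M), (normc a * c); split.
  by rewrite mulr_ge0// normc_ge0.
move=> f g d fr gr fg; have [p1 d1] := h f g d fr gr fg.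
split; first exact: (sob_boundedZ C_large).
rewrite -mulrA; apply: sob_bounded_ext (sob_boundedZ C_large a d1) => x.
by rewrite mulrBr.
Qed.

Lemma lipschitz_sum r (I : eqType) (s : seq I) (phi : I -> R[i] -> R[i]) :
  (forall i, i \in s -> lipschitz_op r (phi i)) ->
  lipschitz_op r (fun z => \sum_(i <- s) phi i z).
Proof.
elim: s => [_|i s IH h].
  exists 0, 0; split => // f g d _ _ _; rewrite mul0r.
  split; exists 0 => [x|]; rewrite ?sob_norm0// (sob_fun0 C_large) !big_nil//.
  by rewrite subrr.
have [M1 [c1 [c10 h1]]] := h i (mem_head _ _).
have [|M2 [c2 [c20 h2]]] := IH.
  by move=> k ks; apply: h; rewrite inE ks orbT.
exists (M1 + M2), (c1 + c2); split => [|f g d fr gr fg]; first exact: addr_ge0.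
have [p1 d1] := h1 f g d fr gr fg; have [p2 d2] := h2 f g d fr gr fg.
split.
  by apply: sob_bounded_ext (sob_boundedD C_large p1 p2) => x; rewrite big_cons.
rewrite mulrDl; apply: sob_bounded_ext (sob_boundedD C_large d1 d2) => x.
by rewrite !big_cons; ring.
Qed.

Definition monomial (ab : nat * nat) (z : R[i]) : R[i] :=
  z ^+ ab.1 * (z^*)%C ^+ ab.2.

Lemma lipschitz_exp r phi n : lipschitz_op r phi ->
  lipschitz_op r (fun z => phi z ^+ n.+1).
Proof.
move=> h; elim: n => [|n IH].
  by rewrite (_ : (fun z => _) = phi)//; apply/funext => z; rewrite expr1.
rewrite (_ : (fun z => _) = (fun z => phi z * phi z ^+ n.+1)).
  exact: lipschitzM.
by apply/funext => z; rewrite exprS.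
Qed.

Lemma lipschitz_monomial r ab : degree_ge2 ab -> lipschitz_op r (monomial ab).
Proof.
case: ab => -[|a] [|b] //= _; rewrite /monomial /=.
- rewrite (_ : (fun z => _) = (fun z : R[i] => (z^*)%C ^+ b.+1)).
    exact/lipschitz_exp/lipschitz_conj.
  by apply/funext => z; rewrite expr0 mul1r.
- rewrite (_ : (fun z => _) = (fun z : R[i] => z ^+ a.+1)).
    exact/lipschitz_exp/lipschitz_id.
  by apply/funext => z; rewrite expr0 mulr1.
- apply: lipschitzM; first exact/lipschitz_exp/lipschitz_id.
  exact/lipschitz_exp/lipschitz_conj.
Qed.

Lemma bounded_monomial f r ab : degree_ge2 ab -> bnd f r ->
  bnd (fun x => monomial ab (f x)) (r ^+ (ab.1 + ab.2)).
Proof.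
case: ab => -[|a] [|b] //= _ fr; rewrite /monomial /=.
- apply: sob_bounded_ext (sob_boundedX C_large b (sob_bounded_conj C_large fr)).
  by move=> x; rewrite expr0 mul1r.
- rewrite addn0; apply: sob_bounded_ext (sob_boundedX C_large a fr) => x.
  by rewrite expr0 mulr1.
- rewrite exprD; apply: (sob_boundedM C_large); apply: (sob_boundedX C_large) => //.
  exact: (sob_bounded_conj C_large).
Qed.

Definition series_poly A (z : R[i]) : R[i] :=
  \sum_(ab <- A) alpha ab.1 ab.2 * monomial ab z.

Lemma lipschitz_poly r A : [set` A] `<=` degree_ge2 ->
  lipschitz_op r (series_poly A).
Proof.
by move=> AD; apply: lipschitz_sum => ab /AD h; exact/lipschitzZ/lipschitz_monomial.
Qed.

(** Its modulus dominates the Sobolev norm of the corresponding term at any function of norm at most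
    [r]. It is kept complex because [abs_bounded] and [abs_tail] take complex families. *)
Definition majorant (r : R) (ab : nat * nat) : R[i] :=
  alpha ab.1 ab.2 * (r%:C)%C ^+ (ab.1 + ab.2).

Lemma normc_majorant r ab : 0 <= r ->
  normc (majorant r ab) = normc (alpha ab.1 ab.2) * r ^+ (ab.1 + ab.2).
Proof. by move=> r0; rewrite normcM normc_exp normc_real ger0_norm. Qed.

Lemma majorant_bounded r : 0 <= r -> (r%:E < Rad)%E ->
  exists M, abs_bounded degree_ge2 (majorant r) M.
Proof.
move=> r0 rR; have := rho_series.1 r r0 rR.
set S := (\esum_(_ in _) _)%E => Soo.
have S0 : (0 <= S)%E.
  by apply: esum_ge0 => ab _; rewrite lee_fin mulr_ge0 ?normc_ge0 ?exprn_ge0.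
exists (fine S) => A AD; rewrite -lee_fin fineK ?ge0_fin_numE//.
under eq_bigr do rewrite normc_majorant//.
apply: esum_fset_le AD => ab.
by rewrite mulr_ge0 ?normc_ge0 ?exprn_ge0.
Qed.

Lemma bounded_poly_tail r A B e f : 0 <= r -> bnd f r ->
  abs_tail degree_ge2 (majorant r) A e -> [set` B] `<=` degree_ge2 ->
  [disjoint A & B]%fset -> bnd (fun x => series_poly B (f x)) e.
Proof.
move=> r0 fr Ae BD AB; apply: sob_bounded_le (Ae B BD AB) _.
apply: (sob_bounded_sum C_large) => ab /BD abD; rewrite normc_majorant//.
by apply: (sob_boundedZ C_large); exact: bounded_monomial.
Qed.

Lemma bounded_polyU r A B e f : 0 <= r -> bnd f r ->
  abs_tail degree_ge2 (majorant r) A e -> [set` A] `<=` degree_ge2 ->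
  [set` B] `<=` degree_ge2 ->
  bnd (fun x => series_poly (A `|` B)%fset (f x) - series_poly A (f x)) e.
Proof.
move=> r0 fr Ae AD BD.
apply: (@sob_bounded_ext _ _ _ _ _
    (fun x => series_poly ((A `|` B) `\` A)%fset (f x))).
  by move=> x; rewrite /series_poly (fset_sumD _ (fsubsetUl A B)) addrAC subrr add0r.
apply: (@bounded_poly_tail r A) => //.
  by move=> ab; rewrite /= !inE => /andP[_ /orP[/AD|/BD]].
by apply/fdisjointP => ab abA; rewrite !inE abA.
Qed.

(** Neither index set need contain the other; both partial sums are compared with the one over the
    union. *)
Lemma bounded_poly2 r A B e1 e2 f : 0 <= r -> bnd f r ->
  abs_tail degree_ge2 (majorant r) A e1 ->
  abs_tail degree_ge2 (majorant r) B e2 -> [set` A] `<=` degree_ge2 ->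
  [set` B] `<=` degree_ge2 ->
  bnd (fun x => series_poly A (f x) - series_poly B (f x)) (e1 + e2).
Proof.
move=> r0 fr A1 B2 AD BD.
have h1 := bounded_polyU r0 fr A1 AD BD; have h2 := bounded_polyU r0 fr B2 BD AD.
rewrite addrC; apply: sob_bounded_ext (sob_boundedB C_large h2 h1) => x.
by rewrite fsetUC; ring.
Qed.

Lemma rho_poly_tail r A e z : 0 <= r -> (r%:E < Rad)%E -> normc z <= r ->
  [set` A] `<=` degree_ge2 -> abs_tail degree_ge2 (majorant r) A e ->
  normc (rho z - series_poly A z) <= e.
Proof.
move=> r0 rR zr AD Ae; rewrite rho_series.2; last by rewrite (le_lt_trans _ rR).
have [M hM] := majorant_bounded r0 rR.
have le ab : normc (alpha ab.1 ab.2 * monomial ab z) <= normc (majorant r ab).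
  rewrite normc_majorant// normcM ler_wpM2l ?normc_ge0//.
  rewrite normcM !normc_exp normc_conj -exprD.
  by rewrite lerXn2r ?nnegrE ?normc_ge0.
under [X in csum _ X]eq_fun do rewrite -mulrA.
apply: (@csum_tail _ _ _ _ M) => // [B BD|B BD AB].
  by apply: le_trans (hM B BD); apply: ler_sum => ab _; exact: le.
by apply: le_trans (Ae B BD AB); apply: ler_sum => ab _; exact: le.
Qed.

(** Besides excluding the default value of [sob_comp], this yields a Sobolev-norm error that depends
    on [v] only through the radius [r], as needed for continuity in [v] and uniformity in time. *)
Lemma sob_comp_exists r v : 0 <= r -> (r%:E < Rad)%E -> sob_norm v <= r ->
  (forall x, sf (sob_comp L rho v) x = rho (sf v x)) /\
  forall A e, [set` A] `<=` degree_ge2 ->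
    abs_tail degree_ge2 (majorant r) A e ->
    bnd (fun x => rho (sf v x) - series_poly A (sf v x)) e.
Proof.
move=> r0 rR vr; have [M hM] := majorant_bounded r0 rR.
have fr : bnd (sf v) r by exists v.
have n0 n : 0 < n.+1%:R^-1 :> R by rewrite invr_gt0.
have nn n m : (n <= m)%N -> m.+1%:R^-1 <= n.+1%:R^-1 :> R.
  by move=> nm; rewrite lef_pV2 ?posrE// ler_nat.
have [A hA] : {A : nat -> {fset nat * nat} & forall n,
    [set` A n] `<=` degree_ge2 /\
    abs_tail degree_ge2 (majorant r) (A n) n.+1%:R^-1}.
  apply: (@choice _ _ (fun n A => [set` A] `<=` degree_ge2 /\
    abs_tail degree_ge2 (majorant r) A n.+1%:R^-1)) => n.
  by have [A AD hA] := abs_tail_exists (n0 n) hM; exists A.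
have [w hw] : {w : nat -> H & forall n x, sf (w n) x = series_poly (A n) (sf v x)}.
  apply: (@choice _ _ (fun n w => forall x, sf w x = series_poly (A n) (sf v x))).
  move=> n; have [M' [c [_ h]]] := lipschitz_poly r (hA n).1.
  have [|[w wE _] _] := h (sf v) (sf v) 0 fr fr; last by exists w.
  by exists 0 => [x|]; rewrite ?sob_norm0// (sob_fun0 C_large) subrr.
have wC n m : (n <= m)%N -> sob_norm (w n - w m) <= 2 * n.+1%:R^-1.
  move=> nm; apply: le_trans (_ : n.+1%:R^-1 + m.+1%:R^-1 <= _).
    apply: (sob_boundedP C_large _ (bounded_poly2 r0 fr (hA n).2 (hA m).2
      (hA n).1 (hA m).1)) => x.
    by rewrite (sob_funB C_large) !hw.
  by rewrite mulr_natl mulr2n lerD2l nn.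
have eps0 : (fun n => 2 * n.+1%:R^-1 : R) @ \oo --> 0.
  have : (fun n => 2 * n.+1%:R^-1 : R) @ \oo --> (2 * 0 : R).
    by apply: cvgMl_tmp; exact: cvg_harmonic.
  by rewrite mulr0.
have [x n|y [hy yw]] := sob_limit C_large (f := fun x => rho (sf v x)) eps0 wC.
  rewrite hw normc_distC; apply: (@le_trans _ _ n.+1%:R^-1).
    apply: (rho_poly_tail r0 rR _ (hA n).1 (hA n).2).
    exact: le_trans (C_large.2 v x) vr.
  by rewrite ler_peMl ?ler1n// ltW.
split.
  exact: (@xgetPex _ (0 : H) [set g : H | forall x, sf g x = rho (sf v x)]
    (ex_intro _ y hy)).
move=> B e BD Be; have [M' [c [_ h]]] := lipschitz_poly r BD.
have [|[q qE _] _] := h (sf v) (sf v) 0 fr fr.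
  by exists 0 => [x|]; rewrite ?sob_norm0// (sob_fun0 C_large) subrr.
exists (y - q) => [x|]; first by rewrite (sob_funB C_large) hy qE.
have := eps0; move=> /cvgrPdist_lt eps0'.
(* The element [y] is reached only through the [w n], whose distances to [y] and tails vanish; so
   the bound [e] holds up to an arbitrary [d]. *)
apply/ler_addgt0Pr => d d0; have d20 : 0 < d / 2 by rewrite divr_gt0.
have [n _ /(_ n (leqnn n))] := eps0' _ d20.
rewrite sub0r normrN ger0_norm; last by rewrite mulr_ge0// ltW.
move=> hn; apply: le_trans (sob_dist_triangle (w n) _ _) _.
rewrite sob_distC.
have : sob_norm (w n - q) <= n.+1%:R^-1 + e.
  apply: (sob_boundedP C_large _ (bounded_poly2 r0 fr (hA n).2 Be (hA n).1 BD)).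
  by move=> x; rewrite (sob_funB C_large) hw qE.
move: (yw n) (n0 n) hn; rewrite /=; set a := n.+1%:R^-1; lra.
Qed.

Lemma sob_comp_cvg (T : Type) (F : set_system T) (FF : Filter F) (f : T -> H) v :
  ((sob_norm v)%:E < Rad)%E -> f @ F --> v ->
  (fun x => sob_comp L rho (f x)) @ F --> sob_comp L rho v.
Proof.
move=> vR /sob_cvgP fv; apply/sob_cvgP => e e0.
(* A radius strictly between the norm of [v] and [Rad] leaves room for [f x], so that one tail bound
   serves both arguments. *)
have [r vr rR] : exists2 r : R, sob_norm v < r & (r%:E < Rad)%E.
  case: Rad vR => [s||//]; rewrite ?lte_fin => vs.
    by exists ((sob_norm v + s) / 2); rewrite ?lte_fin midf_lt.
  by exists (sob_norm v + 1); rewrite ?ltrDl// ltry.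
have r0 : 0 <= r by rewrite (le_trans _ (ltW vr))// sob_norm_ge0.
have e30 : 0 < e / 3 by rewrite divr_gt0.
have [M hM] := majorant_bounded r0 rR.
have [A AD Ae] := abs_tail_exists e30 hM.
have [M' [c [c0 hL]]] := lipschitz_poly r AD.
have d0 : 0 < Num.min (r - sob_norm v) (e / 3 / (1 + c)).
  rewrite lt_min subr_gt0 vr/= divr_gt0// ltr_pwDl//.
near=> x.
have : sob_norm (v - f x) < Num.min (r - sob_norm v) (e / 3 / (1 + c)).
  by near: x; exact: fv.
rewrite lt_min => /andP[h1 h2].
have fxr : sob_norm (f x) <= r.
  have := sob_normD v (- (v - f x)); rewrite opprB addrC subrK sob_distC; lra.
have [s1 a1] := sob_comp_exists r0 rR (ltW vr).
have [s2 a2] := sob_comp_exists r0 rR fxr.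
have bv : bnd (sf v) r by exists v => //; exact: ltW.
have bf : bnd (sf (f x)) r by exists (f x).
have bd : bnd (fun y => sf v y - sf (f x) y) (sob_norm (v - f x)).
  by exists (v - f x) => // y; rewrite (sob_funB C_large).
have [_ bp] := hL _ _ _ bv bf bd.
have := sob_boundedB C_large (sob_boundedD C_large (a1 A _ AD Ae) bp) (a2 A _ AD Ae).
move=> /(sob_boundedP C_large (w := sob_comp L rho v - sob_comp L rho (f x))) h.
apply: le_lt_trans (h _) _ => [y|].
  by rewrite (sob_funB C_large) s1 s2; ring.
have : c * sob_norm (v - f x) < e / 3.
  apply: le_lt_trans (_ : (1 + c) * sob_norm (v - f x) < _).
    by rewrite ler_wpM2r ?sob_norm_ge0// lerDr.
  by rewrite mulrC -ltr_pdivlMr// ltr_pwDl.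
lra.
Unshelve. all: by end_near. Qed.

End Composition.

(** * The Schroedinger group *)

Section Schrodinger.
Variables (R : realType) (L l : R) (C : {posnum R}).
Local Notation H := (sobolev l C).
Local Notation S := (@schrodinger R L l C).
Implicit Types (u v w : H) (s t : R) (K : int).

Lemma coef_schrodinger t u K :
  S t u K = expi (- (t * (2 * pi * K%:~R / L) ^+ 2)) * (u K : R[i]) :> R[i].
Proof. by []. Qed.

Lemma schrodingerD t u v : S t (u + v) = S t u + S t v.
Proof. by apply: coef_inj => K; rewrite coefD !coef_schrodinger coefD mulrDr. Qed.

Lemma schrodingerZ t (a : R[i]) u : S t (a *: u) = a *: S t u.
Proof. by apply: coef_inj => K; rewrite coefZ !coef_schrodinger coefZ mulrCA. Qed.

Lemma schrodingerB t u v : S t (u - v) = S t u - S t v.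
Proof. by rewrite schrodingerD -scaleN1r schrodingerZ scaleN1r. Qed.

Lemma schrodinger_sum t (I : Type) (r : seq I) (f : I -> H) :
  S t (\sum_(i <- r) f i) = \sum_(i <- r) S t (f i).
Proof.
elim: r => [|i r IH]; last by rewrite !big_cons schrodingerD IH.
by rewrite !big_nil; have := schrodingerB t 0 0; rewrite !subrr.
Qed.

Lemma schrodingerA s t u : S s (S t u) = S (s + t) u.
Proof.
by apply: coef_inj => K; rewrite !coef_schrodinger mulrA -expiD -opprD
  [(s + t) * _]mulrDl.
Qed.

Lemma schrodinger0 u : S 0 u = u.
Proof.
by apply: coef_inj => K; rewrite coef_schrodinger mul0r oppr0 expi0 mul1r.
Qed.

Lemma schrodinger_norm t u : sob_norm (S t u) = sob_norm u.
Proof.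
by apply/eqP; rewrite eq_le; apply/andP; split; apply: sob_norm_coef_le => K;
  rewrite coef_schrodinger normcM normc_expi mul1r.
Qed.

Lemma schrodinger_basis t K :
  S t (basis l C K) = expi (- (t * (2 * pi * K%:~R / L) ^+ 2)) *: basis l C K.
Proof.
apply: coef_inj => J; rewrite coefZ coef_schrodinger basisE.
by case: eqP => [->//|_]; rewrite !mulr0.
Qed.

(** The frequency of mode [K] times [tau_P] is [2 * pi * K ^+ 2], an integer multiple of a full
    turn. *)
Lemma schrodinger_period t u : 0 < L -> S (tau_period L - t) u = S (- t) u.
Proof.
move=> L0; apply: coef_inj => K; rewrite !coef_schrodinger; congr (_ * _).
rewrite mulrBl opprB expiD [X in _ * X](_ : _ = 1).
  by rewrite mulr1 mulNr opprK.
rewrite (_ : - _ = 2 * pi * (- K ^+ 2)%:~R) ?expi_2piz//.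
rewrite mulrNz /tau_period; move: (pi) (pi_gt0 R) => p p0; rewrite rmorphXn /=.
by move: (K%:~R) => k; field; rewrite !gt_eqF.
Qed.

(** The phases do not converge uniformly in [K], so [u] is truncated first and only finitely many
    phases have to converge. Since [S] is an isometry, both truncation errors and the distance from
    [f x] to [u] are unaffected: four errors in all, hence [e / 4]. *)
Lemma schrodinger_cvg (T : Type) (F : set_system T) (FF : Filter F)
    (s : T -> R) (f : T -> H) (s0 : R) u :
  s @ F --> s0 -> f @ F --> u -> (fun x => S (s x) (f x)) @ F --> S s0 u.
Proof.
move=> cs /sob_cvgP cf; apply/sob_cvgP => e e0.
have e40 : 0 < e / 4 by rewrite divr_gt0.
have [A hA] := trunc_dense u e40; have {}hA := hA A (fsubset_refl A).
pose k K : R := (2 * pi * K%:~R / L) ^+ 2.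
pose c K : R := normc (u K) * sob_norm (basis l C K).
(* The modulus of a difference of phases is bounded by the differences of cosines and sines, which
   are continuous real functions. *)
pose g x K : R := (`|cos (- (s0 * k K)) - cos (- (s x * k K))| +
  `|sin (- (s0 * k K)) - sin (- (s x * k K))|) * c K.
have c0 K : 0 <= c K by rewrite mulr_ge0 ?normc_ge0 ?sob_norm_ge0.
have gcvg : (fun x => \sum_(K <- A) g x K) @ F --> \sum_(K <- A) (0 : R).
  apply: (@cvg_sum_seq _ _ _ _ F FF _ (fun K x => g x K) (fun=> 0)) => K.
  have ck : (fun x => - (s x * k K)) @ F --> - (s0 * k K).
    by apply: cvgN; exact: cvgMr_tmp.
  rewrite -(mul0r (c K)); apply: cvgMr_tmp.
  have z : 0 = `|cos (- (s0 * k K)) - cos (- (s0 * k K))| +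
    `|sin (- (s0 * k K)) - sin (- (s0 * k K))| by rewrite !subrr !normr0 addr0.
  rewrite [X in _ --> X]z; apply: cvgD; apply: cvg_norm; apply: cvgB.
  - exact: cvg_cst.
  - by apply: continuous_cvg => //; exact: continuous_cos.
  - exact: cvg_cst.
  - by apply: continuous_cvg => //; exact: continuous_sin.
have g_le x : sob_norm (S s0 (trunc A u) - S (s x) (trunc A u)) <=
    \sum_(K <- A) g x K.
  rewrite !schrodinger_sum -sumrB; apply: le_trans (sob_norm_sum _ _) _.
  apply: ler_sum => K _; rewrite !schrodingerZ !schrodinger_basis !scalerA.
  rewrite -scalerBl -mulrBr sob_normZ normcM /g /c [leRHS]mulrCA mulrA.
  rewrite ler_wpM2r ?sob_norm_ge0// ler_wpM2l ?normc_ge0//.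
  exact: normc_le_parts.
move: gcvg; rewrite big1// => /cvgrPdist_lt/(_ _ e40) gs.
have fs := cf _ e40.
near=> x.
apply: le_lt_trans (sob_dist_triangle (S (s x) u) _ _) _.
rewrite -schrodingerB schrodinger_norm.
have h1 : sob_norm (u - f x) < e / 4 by near: x.
have h2 : `|0 - \sum_(K <- A) g x K| < e / 4 by near: x.
have h3 : sob_norm (S s0 u - S (s x) u) <= e / 4 + e / 4 + \sum_(K <- A) g x K.
  apply: le_trans (sob_dist_triangle (S s0 (trunc A u)) _ _) _.
  rewrite -addrA lerD// -?schrodingerB ?schrodinger_norm//.
  apply: le_trans (sob_dist_triangle (S (s x) (trunc A u)) _ _) _.
  rewrite addrC lerD//.
  by rewrite -schrodingerB schrodinger_norm sob_distC.
have := le_lt_trans (ler_norm _) h2; rewrite -normrN in h2.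
have := le_lt_trans (ler_norm _) h2; lra.
Unshelve. all: by end_near. Qed.

End Schrodinger.

(** * Bochner integrals of uniform limits of simple functions *)

(* [\int] of a nonnegative function is the supremum of the integrals of the
   simple functions below it, so monotonicity needs no measurability. *)
Lemma ge0_le_integral_any d (T : measurableType d) (R : realType)
    (mu : {measure set T -> \bar R}) (D : set T) (f g : T -> \bar R) :
  (forall x, D x -> (0 <= f x)%E) -> (forall x, D x -> (f x <= g x)%E) ->
  (\int[mu]_(x in D) f x <= \int[mu]_(x in D) g x)%E.
Proof.
move=> f0 fg; have g0 x : D x -> (0 <= g x)%E.
  by move=> Dx; exact: le_trans (f0 _ Dx) (fg _ Dx).
rewrite !ge0_integralE//.
apply: le_ereal_sup => _ [h /= hf <-]; exists h => //= x.
apply: le_trans (hf x) _; rewrite /patch; case: ifPn => // /set_mem Dx.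
exact: fg.
Qed.

Import HBNNSimple.

(** Stated as an inequality because [f] may fail to be measurable: a simple function below [a * f]
    is divided by [a] and compared with [f]. *)
Lemma ge0_integralZl_le d (T : measurableType d) (R : realType)
    (mu : {measure set T -> \bar R}) (D : set T) (f : T -> R) (a : R) :
  0 < a -> (forall x, D x -> 0 <= f x) ->
  (\int[mu]_(x in D) (a * f x)%:E <= a%:E * \int[mu]_(x in D) (f x)%:E)%E.
Proof.
move=> a0 f0; rewrite ge0_integralE; last first.
  by move=> x Dx; rewrite lee_fin mulr_ge0 ?f0// ltW.
apply: ge_ereal_sup => _ [h /= hf <-].
rewrite -integralT_nnsfun (integral_mkcond D).
have mh : measurable_fun setT (fun x : T => a^-1 * h x).
  by apply: measurable_funM => //; exact: measurable_cst.
have -> : (\int[mu]_x (h x)%:E = a%:E * \int[mu]_x (a^-1 * h x)%:E)%E.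
  rewrite -ge0_integralZl//.
  - apply: eq_integral => x _; rewrite -EFinM mulrA mulfV ?mul1r//.
    by rewrite gt_eqF.
  - exact/measurable_EFinP.
  - by move=> x _; rewrite lee_fin mulr_ge0 ?invr_ge0 ?(ltW a0)// fun_ge0.
  - by rewrite lee_fin ltW.
apply: lee_pmul; rewrite ?lee_fin ?(ltW a0)//.
  apply: integral_ge0 => x _.
  by rewrite lee_fin mulr_ge0 ?invr_ge0 ?(ltW a0)// fun_ge0.
apply: ge0_le_integral_any => x _.
  by rewrite lee_fin mulr_ge0 ?invr_ge0 ?(ltW a0)// fun_ge0.
have := hf x; rewrite /patch; case: ifPn => _; rewrite !lee_fin.
  by rewrite ler_pdivrMl.
move=> hx; suff -> : h x = 0 by rewrite mulr0.
by apply/eqP; rewrite eq_le hx fun_ge0.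
Qed.

Section SimpleFunctions.
Context d (T : measurableType d) (R : realType) (V : normedModType R[i]).
Variable mu : {measure set T -> \bar R}.
Implicit Types (s : seq (set T * V)) (D A : set T) (v : V).

Local Notation nrm v := (complex.Re `|v|).

Lemma ReD (x y : R[i]) : complex.Re (x + y) = complex.Re x + complex.Re y.
Proof. by case: x y => ? ? []. Qed.

Lemma nrm_ge0 v : 0 <= nrm v.
Proof. by have := normr_ge0 v; rewrite lecE => /andP[]. Qed.

Lemma nrmD v w : nrm (v + w) <= nrm v + nrm w.
Proof. by have := ler_normD v w; rewrite lecE ReD => /andP[]. Qed.

Lemma nrmN v : nrm (- v) = nrm v. Proof. by rewrite normrN. Qed.

Lemma nrm_real v : (nrm v)%:C%C = `|v|.
Proof. by apply: RRe_real; exact: normr_real. Qed.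

Lemma nrmZ (a : R) v : nrm (a%:C%C *: v) = `|a| * nrm v.
Proof.
rewrite normrZ -[in LHS](nrm_real v) (_ : `|a%:C%C| = `|a|%:C%C).
  by rewrite -rmorphM.
by rewrite (normc_def a%:C%C) /= expr0n addr0 sqrtr_sqr.
Qed.

Lemma simple_fun_cons A v s x :
  simple_fun ((A, v) :: s) x = (\1_A x)%:C%C *: v + simple_fun s x :> V.
Proof. by rewrite /simple_fun big_cons. Qed.

Lemma simple_integral_cons A v s : simple_integral mu ((A, v) :: s) =
  (fine (mu A))%:C%C *: v + simple_integral mu s.
Proof. by rewrite /simple_integral big_cons. Qed.

Lemma simple_fun_in A v s x : A x ->
  simple_fun ((A, v) :: s) x = v + simple_fun s x :> V.
Proof. by move=> Ax; rewrite simple_fun_cons indicE mem_set// scale1r. Qed.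

Lemma simple_fun_out A v s x : ~ A x ->
  simple_fun ((A, v) :: s) x = simple_fun s x :> V.
Proof.
by move=> Ax; rewrite simple_fun_cons indicE memNset//= scale0r add0r.
Qed.

Definition measurable_list s := forall Av, Av \in s -> measurable Av.1.

Lemma measurable_list_cons Av s : measurable_list (Av :: s) ->
  measurable Av.1 /\ measurable_list s.
Proof.
by move=> h; split=> [|Bw Bs]; apply: h; rewrite inE ?eqxx ?Bs ?orbT.
Qed.

(** Measurability is asked only of the real-valued norm. Splitting [D] along the first set of the
    list makes its contribution constant on each piece, and [v] absorbs that constant in the
    induction. *)
Lemma measurable_simple_norm s D v : measurable D -> measurable_list s ->
  measurable_fun D (fun x => nrm (v + simple_fun s x)).
Proof.
elim: s D v => [|[A w] s IH] D v mD ms.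
  rewrite (_ : (fun x => _) = cst (nrm v)); first exact: measurable_cst.
  by apply/funext => x; rewrite /simple_fun big_nil addr0.
have [/= mA {}ms] := measurable_list_cons ms.
rewrite -(setUIDK D A); apply/measurable_funU.
- exact: measurableI.
- exact: measurableD.
split.
  apply: (eq_measurable_fun (fun x => nrm ((v + w) + simple_fun s x))).
    by move=> x /set_mem[_ Ax]; rewrite simple_fun_in// addrA.
  by apply: IH => //; exact: measurableI.
apply: (eq_measurable_fun (fun x => nrm (v + simple_fun s x))).
  by move=> x /set_mem[_ Ax]; rewrite simple_fun_out.
by apply: IH => //; exact: measurableD.
Qed.

(* Splitting [D] along the first set of the list keeps the bound additive. *)
Lemma norm_simple_integral_in s D v : measurable D -> (mu D < +oo)%E ->
  measurable_list s ->
  ((nrm ((fine (mu D))%:C%C *: v +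
     \sum_(Aw <- s) (fine (mu (D `&` Aw.1)))%:C%C *: Aw.2))%:E <=
   \int[mu]_(x in D) (nrm (v + simple_fun s x))%:E)%E.
Proof.
elim: s D v => [|[A w] s IH] D v mD Doo ms.
  rewrite big_nil addr0 nrmZ ger0_norm ?fine_ge0//.
  under eq_integral do rewrite /simple_fun big_nil addr0.
  by rewrite integral_cst// EFinM fineK ?ge0_fin_numE// muleC.
have [/= mA {}ms] := measurable_list_cons ms.
have mI := measurableI _ _ mD mA; have mN := measurableD mD mA.
have Ioo : (mu (D `&` A) < +oo)%E.
  by apply: le_lt_trans Doo; rewrite le_measure ?inE//; exact: subIsetl.
have Noo : (mu (D `\` A) < +oo)%E.
  by apply: le_lt_trans Doo; rewrite le_measure ?inE//; exact: subDsetl.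
have split_mu B : measurable B -> fine (mu (D `&` B)) =
    fine (mu (D `&` A `&` B)) + fine (mu ((D `\` A) `&` B)).
  move=> mB; have mIB := measurableI _ _ mI mB; have mNB := measurableI _ _ mN mB.
  rewrite -fineD; first 1 last.
  - rewrite ge0_fin_numE//; apply: le_lt_trans Ioo.
    by rewrite le_measure ?inE//; exact: subIsetl.
  - rewrite ge0_fin_numE//; apply: le_lt_trans Noo.
    by rewrite le_measure ?inE//; exact: subIsetl.
  congr fine; rewrite -measureU//; last first.
    by apply/seteqP; split => // x [[[_ Ax] _] [[_ nAx] _]].
  by rewrite -setIUl setUIDK.
have split_D : fine (mu D) = fine (mu (D `&` A)) + fine (mu (D `\` A)).
  by have := split_mu setT measurableT; rewrite !setIT.
have -> : (\int[mu]_(x in D) (nrm (v + simple_fun ((A, w) :: s) x))%:E =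
  \int[mu]_(x in D `&` A) (nrm (v + w + simple_fun s x))%:E +
  \int[mu]_(x in D `\` A) (nrm (v + simple_fun s x))%:E)%E.
  rewrite -[in LHS](setUIDK D A) ge0_integral_setU//=.
  - congr (_ + _)%E; apply: eq_integral => x /set_mem[_ Ax].
      by rewrite simple_fun_in// addrA.
    by rewrite simple_fun_out.
  - apply/measurable_EFinP; rewrite setUIDK; apply: measurable_simple_norm => //.
    by move=> Bw; rewrite inE => /orP[/eqP->//|/ms].
  - by move=> x _; rewrite lee_fin nrm_ge0.
  - by apply/disj_setPS => x [[_ Ax] [_ nAx]].
apply: le_trans (leeD (IH _ (v + w) mI Ioo ms) (IH _ v mN Noo ms)).
rewrite -EFinD lee_fin big_cons /= split_D.
rewrite [X in nrm (_ + (_ + X))](_ : _ =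
  \sum_(Bw <- s) (fine (mu (D `&` A `&` Bw.1)))%:C%C *: Bw.2 +
  \sum_(Bw <- s) (fine (mu ((D `\` A) `&` Bw.1)))%:C%C *: Bw.2).
  apply: le_trans (nrmD _ _); rewrite rmorphD scalerDl scalerDr.
  by rewrite le_eqVlt; apply/orP; left; apply/eqP; congr (nrm _);
    rewrite !addrA; congr (_ + _); rewrite -!addrA; congr (_ + _);
    rewrite addrCA; congr (_ + _); rewrite addrC.
rewrite -big_split /= big_seq [RHS]big_seq; apply: eq_bigr => Bw Bs.
by rewrite -scalerDl -rmorphD -split_mu//; exact: ms.
Qed.

Lemma norm_simple_integral s D : measurable D -> (mu D < +oo)%E ->
  simple_on mu D s ->
  ((nrm (simple_integral mu s))%:E <=
   \int[mu]_(x in D) (nrm (simple_fun s x))%:E)%E.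
Proof.
move=> mD Doo sD.
have ms : measurable_list s by move=> Av /sD[].
have := norm_simple_integral_in 0 mD Doo ms.
rewrite scaler0 add0r; under [in leRHS]eq_integral do rewrite add0r.
rewrite (_ : \sum_(Aw <- s) _ = simple_integral mu s)//.
rewrite /simple_integral big_seq [RHS]big_seq; apply: eq_bigr => Av Avs.
by have [_ AD _] := sD _ Avs; rewrite setIC (setIidl AD).
Qed.

Definition simple_opp s := [seq (Av.1, - Av.2) | Av <- s].

Lemma simple_fun_sub s1 s2 x :
  simple_fun (s1 ++ simple_opp s2) x = simple_fun s1 x - simple_fun s2 x :> V.
Proof.
rewrite /simple_fun big_cat big_map /= -sumrN; congr (_ + _).
by apply: eq_bigr => Av _; rewrite scalerN.
Qed.

Lemma simple_integral_sub s1 s2 : simple_integral mu (s1 ++ simple_opp s2) =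
  simple_integral mu s1 - simple_integral mu s2.
Proof.
rewrite /simple_integral big_cat big_map /= -sumrN; congr (_ + _).
by apply: eq_bigr => Av _; rewrite scalerN.
Qed.

Lemma simple_on_sub D s1 s2 : simple_on mu D s1 -> simple_on mu D s2 ->
  simple_on mu D (s1 ++ simple_opp s2).
Proof.
move=> h1 h2 Av; rewrite mem_cat => /orP[/h1//|/mapP[Bw /h2 hB ->]].
exact: hB.
Qed.

(* The integrand [|f - simple_fun s|] need not be measurable, so the error [e]
   is absorbed on the measurable side. *)
Lemma simple_integral_dist D (f : T -> V) s1 s2 (e : R) : measurable D ->
  (mu D < +oo)%E -> simple_on mu D s1 -> simple_on mu D s2 -> 0 <= e ->
  (forall x, D x -> nrm (f x - simple_fun s2 x) <= e) ->
  ((nrm (simple_integral mu s1 - simple_integral mu s2))%:E <=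
   \int[mu]_(x in D) (nrm (f x - simple_fun s1 x))%:E + e%:E * mu D)%E.
Proof.
move=> mD Doo h1 h2 e0 fs2; rewrite -simple_integral_sub.
have h12 := simple_on_sub h1 h2.
apply: le_trans (norm_simple_integral mD Doo h12) _.
pose h x := nrm (simple_fun (s1 ++ simple_opp s2) x).
have mh : measurable_fun D h.
  have ms : measurable_list (s1 ++ simple_opp s2) by move=> Av /h12[].
  apply: (eq_measurable_fun (fun x => nrm (0 + simple_fun (s1 ++ simple_opp s2) x))).
    by move=> x _; rewrite add0r.
  exact: measurable_simple_norm.
(* The truncated difference is measurable and lies below the norm of [f - simple_fun s1], since [h]
   exceeds that norm by at most [e]. *)
have mk : measurable_fun D (fun x => Num.max (h x - e) 0).
  apply: measurable_maxr => //; apply: measurable_funB => //.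
apply: (@le_trans _ _ (\int[mu]_(x in D) ((Num.max (h x - e) 0)%:E + e%:E))%E).
  apply: ge0_le_integral_any => x Dx; rewrite ?lee_fin ?nrm_ge0//.
  by rewrite -/(h x) -lerBlDr le_max lexx.
rewrite ge0_integralD//=.
- apply: leeD; last by rewrite integral_cst.
  apply: ge0_le_integral_any => x Dx; rewrite lee_fin.
    by rewrite le_max lexx orbT.
  rewrite ge_max nrm_ge0 andbT lerBlDr /h simple_fun_sub.
  rewrite (_ : _ - _ = - (f x - simple_fun s1 x) + (f x - simple_fun s2 x)).
    by rewrite (le_trans (nrmD _ _))// nrmN lerD2l fs2.
  by rewrite opprB addrA subrK.
- by move=> x _; rewrite lee_fin le_max lexx orbT.
- exact/measurable_EFinP.
Qed.

(** An arbitrary admissible sequence [s'] is compared with the uniform one: the distance of their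
    integrals is at most the L^1 error of [s'] plus [eps n] times the measure of [D]. This is what
    makes the Bochner integral single-valued here. *)
Lemma bochner_integral_uniform D (f : T -> V) (s : nat -> seq (set T * V))
    (eps : nat -> R) (I : V) : measurable D -> (mu D < +oo)%E ->
  (forall n, simple_on mu D (s n)) -> eps @ \oo --> 0 ->
  (forall n x, D x -> nrm (f x - simple_fun (s n) x) <= eps n) ->
  bochner_integral mu D f I <-> simple_integral mu (s n) @[n --> \oo] --> I.
Proof.
move=> mD Doo sD eps0 fs.
have abs0 : (fun n => `|eps n|) @ \oo --> 0 by rewrite -(normr0 R); exact: cvg_norm.
have {}fs n x : D x -> nrm (f x - simple_fun (s n) x) <= `|eps n|.
  by move=> Dx; rewrite (le_trans (fs n x Dx))// ler_norm.
have nrmP (u : nat -> V) y : u @ \oo --> y <->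
    forall e : R, 0 < e -> \forall n \near \oo, nrm (y - u n) < e.
  split=> [/cvgrPdist_lt h e e0|h].
    have /h : 0 < e%:C%C by rewrite ltcR.
    by apply: filterS => x; rewrite -nrm_real ltcR.
  apply/cvgrPdist_lt => e; rewrite ltcE /= => /andP[/eqP e1 /h].
  by apply: filterS => x; rewrite -nrm_real ltcE /= -e1 eqxx.
have emu : (fun n => `|eps n|%:E * mu D)%E @ \oo --> 0%E.
  rewrite -(fineK (_ : mu D \is a fin_num)) ?ge0_fin_numE//.
  under eq_fun do rewrite -EFinM.
  apply: cvg_EFin; first by near=> n.
  rewrite -(mul0r (fine (mu D))); exact: cvgMr_tmp.
split=> [[s' [sD' _ int0 cI]]|cI].
  apply/nrmP => e e0; have e20 : 0 < e / 2 by rewrite divr_gt0.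
  have c0 := cvgeD (isT : (0 : \bar R) +? 0)%E int0 emu; rewrite adde0 in c0.
  have near1 : \forall n \near \oo, nrm (I - simple_integral mu (s' n)) < e / 2.
    by move/nrmP: cI; exact.
  have near2 : \forall n \near \oo,
      (\int[mu]_(x in D) (nrm (f x - simple_fun (s' n) x))%:E +
        `|eps n|%:E * mu D < (e / 2)%:E)%E.
    have e2 : (0 < (e / 2)%:E)%E by rewrite lte_fin.
    exact: (c0 _ _ (open_ereal_lt' e2)).
  near=> n.
  have h1 : nrm (I - simple_integral mu (s' n)) < e / 2 by near: n.
  have := simple_integral_dist mD Doo (sD' n) (sD n) (normr_ge0 _) (fs n).
  move=> /le_lt_trans h2; have {}h2 : ((nrm (simple_integral mu (s' n) -
      simple_integral mu (s n)))%:E < (e / 2)%:E)%E.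
    by apply: h2; near: n.
  rewrite lte_fin in h2; rewrite -(subrK (simple_integral mu (s' n)) I) -addrA.
  by rewrite (le_lt_trans (nrmD _ _))// [ltRHS]splitr ltrD.
exists s; split => //.
  apply/aeW => x Dx; apply/nrmP => e e0; move/cvgrPdist_lt: abs0 => /(_ e e0).
  apply: filterS => n; rewrite sub0r normrN normr_id; exact: le_lt_trans (fs n x Dx).
apply: (squeeze_cvge _ (cvg_cst 0%E) emu); near=> n; apply/andP; split.
  by apply: integral_ge0 => x _; rewrite lee_fin nrm_ge0.
rewrite -integral_cst//; apply: ge0_le_integral_any => x Dx.
  by rewrite lee_fin nrm_ge0.
by rewrite lee_fin fs.
Unshelve. all: by end_near. Qed.

End SimpleFunctions.

Lemma bochner_integralZ d (T : measurableType d) (R : realType)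
    (V : normedModType R[i]) (mu : {measure set T -> \bar R}) (D : set T)
    (f g : T -> V) (a : R) (I : V) :
  (forall x, D x -> g x = a%:C%C *: f x) ->
  bochner_integral mu D f I -> bochner_integral mu D g (a%:C%C *: I).
Proof.
move=> gf [s [sD ae_s int0 cI]].
pose s' n := [seq (Av.1, a%:C%C *: Av.2) | Av <- s n].
have sf n x : simple_fun (s' n) x = a%:C%C *: simple_fun (s n) x :> V.
  rewrite /simple_fun big_map scaler_sumr; apply: eq_bigr => Av _ /=.
  by rewrite !scalerA mulrC.
exists s'; split.
- by move=> n Av /mapP[Bw /sD hB ->].
- apply: filterS ae_s => x h Dx; rewrite gf//.
  under eq_fun do rewrite sf.
  by apply: cvgZl_tmp; exact: h.
(* The factor is [|a| + 1] rather than [|a|] because [ge0_integralZl_le] asks for a positive one and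
   [a] may be 0. *)
- have cZ : (fun n => (`|a| + 1)%:E * \int[mu]_(x in D)
      (complex.Re `|f x - simple_fun (s n) x|)%:E)%E @ \oo --> 0%E.
    by rewrite -[X in _ --> X](mule0 (`|a| + 1)%:E); exact: cvgeZl.
  apply: (squeeze_cvge _ (cvg_cst 0%E) cZ); near=> n; apply/andP; split.
    by apply: integral_ge0 => x _; rewrite lee_fin nrm_ge0.
  apply: le_trans (ge0_integralZl_le _ _ _); last 2 first.
  - by rewrite ltr_pwDr.
  - by move=> x _; exact: nrm_ge0.
  apply: ge0_le_integral_any => x Dx; rewrite lee_fin ?nrm_ge0//.
  rewrite gf// sf -scalerBr nrmZ ler_wpM2r ?nrm_ge0//.
  by rewrite lerDl.
- rewrite (_ : (fun n => _) = (fun n => a%:C%C *: simple_integral mu (s n))).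
    exact: cvgZl_tmp.
  apply/funext => n; rewrite /simple_integral big_map scaler_sumr.
  by apply: eq_bigr => Av _ /=; rewrite !scalerA mulrC.
Unshelve. all: by end_near. Qed.

(** * Riemann sums *)

Section RiemannSums.
Variables (R : realType) (V : normedModType R[i]).
Implicit Types (f : R -> V) (b w x : R) (n j : nat).
Local Notation mu := (@lebesgue_measure R).
Local Notation nrm v := (complex.Re `|v|).

Definition node b n j : R := j%:R * (b / n.+1%:R).

(* The null cell [[set b]] makes the approximation uniform up to the endpoint,
   and takes care of [b = 0]. *)
Definition riemann_simple f b n : seq (set R * V) :=
  ([set b], f b) ::
  [seq (`[node b n j, node b n j.+1[%classic, f (node b n j)) | j <- index_iota 0 n.+1].

Definition riemann_sum f b n : V :=
  (b / n.+1%:R)%:C%C *: \sum_(j < n.+1) f (node b n j).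

Lemma node_ge0 b n j : 0 <= b -> 0 <= node b n j.
Proof. by move=> b0; rewrite mulr_ge0// divr_ge0. Qed.

Lemma node_le b n j : 0 <= b -> (j <= n.+1)%N -> node b n j <= b.
Proof.
move=> b0 jn; rewrite /node mulrCA ler_piMr// ler_pdivrMr// mul1r.
by rewrite ler_nat.
Qed.

Lemma node_last b n : node b n n.+1 = b.
Proof. by rewrite /node mulrCA divff ?mulr1// pnatr_eq0. Qed.

Lemma nodeS b n j : node b n j.+1 = node b n j + b / n.+1%:R.
Proof. by rewrite /node -natr1 mulrDl mul1r. Qed.

Lemma node_leS b n j : 0 <= b -> node b n j <= node b n j.+1.
Proof. by move=> b0; rewrite nodeS lerDl divr_ge0. Qed.

Lemma lebesgue_cell b n j : 0 <= b ->
  mu `[node b n j, node b n j.+1[%classic = (b / n.+1%:R)%:E.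
Proof.
move=> b0; rewrite lebesgue_measure_itv /= lte_fin -EFinD nodeS.
rewrite addrAC subrr add0r; case: ifPn => //.
by rewrite ltrDl -leNgt => h; congr EFin; apply/eqP; rewrite eq_le h divr_ge0.
Qed.

Lemma riemann_simple_on f b n : 0 <= b ->
  simple_on mu `[0, b]%classic (riemann_simple f b n).
Proof.
move=> b0 Av; rewrite inE => /orP[/eqP->|/mapP[j]].
  split => //=; last by rewrite lebesgue_measure_set1.
  by move=> _ ->; rewrite /= in_itv /= lexx b0.
rewrite mem_index_iota => /andP[_ jn] -> /=; split => //.
  move=> x; rewrite /= !in_itv /= => /andP[x1 x2].
  rewrite (le_trans (node_ge0 _ _ b0) x1) ltW// (lt_le_trans x2)//.
  exact: node_le.
by rewrite lebesgue_cell// ltry.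
Qed.

Lemma riemann_simple_integral f b n : 0 <= b ->
  simple_integral mu (riemann_simple f b n) = riemann_sum f b n.
Proof.
move=> b0; rewrite /riemann_simple simple_integral_cons.
rewrite [X in (fine X)%:C%C *: f b + _]lebesgue_measure_set1.
rewrite scale0r add0r /simple_integral big_map /riemann_sum scaler_sumr
  -(big_mkord xpredT
  (fun j => (b / n.+1%:R)%:C%C *: f (node b n j))).
by apply: eq_bigr => j _; rewrite /= lebesgue_cell.
Qed.

(** Written as a difference of two step functions, the indicators telescope to the partition of
    unity in [sum_indic_cell]. *)
Lemma indic_cell b n j x : 0 <= b ->
  \1_(`[node b n j, node b n j.+1[%classic) x =
  (x < node b n j.+1)%R%:R - (x < node b n j)%R%:R :> R.
Proof.
move=> b0; rewrite indicE mem_setE in_itv /= leNgt.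
have := node_leS n j b0; case: (ltP x (node b n j)) => /= h1 h2.
  by rewrite (lt_le_trans h1 h2) subrr.
by rewrite subr0.
Qed.

Lemma sum_indic_cell b n x : 0 <= x -> x < b ->
  \sum_(j <- index_iota 0 n.+1) \1_(`[node b n j, node b n j.+1[%classic) x = 1 :> R.
Proof.
move=> x0 xb; have b0 := ltW (le_lt_trans x0 xb).
under eq_bigr do rewrite indic_cell//.
have := @telescope_sumr _ 0 n.+1 (fun j => (x < node b n j)%R%:R : R) (leq0n _).
move=> ->.
by rewrite node_last xb /node mul0r ltNge x0 subr0.
Qed.

Lemma nrm_sum (I : Type) (s : seq I) (g : I -> V) :
  nrm (\sum_(i <- s) g i) <= \sum_(i <- s) nrm (g i).
Proof.
elim: s => [|i s IH]; first by rewrite !big_nil normr0.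
by rewrite !big_cons (le_trans (nrmD _ _))// lerD2l.
Qed.

Lemma riemann_simple_dist f b n w : 0 <= b -> 0 <= w ->
  (forall s s', 0 <= s <= b -> 0 <= s' <= b -> `|s - s'| <= b / n.+1%:R ->
     nrm (f s - f s') <= w) ->
  forall x, 0 <= x <= b -> nrm (f x - simple_fun (riemann_simple f b n) x) <= w.
Proof.
move=> b0 w0 fw x /andP[x0]; rewrite le_eqVlt => /predU1P[->|xb].
  rewrite simple_fun_in// /simple_fun big_map big1_seq ?addr0 ?subrr ?normr0//.
  move=> j /andP[_]; rewrite mem_index_iota => /andP[_ jn].
  rewrite indic_cell// !ltNge !node_le ?(ltnW jn)//.
  by rewrite subrr scale0r.
rewrite simple_fun_out; last by move=> /= xb'; rewrite xb' ltxx in xb.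
(* The value [f x] is spread over the partition of unity, so the error is compared cell by cell. *)
rewrite /simple_fun big_map -[f x](scale1r).
rewrite -[1](rmorph1 (@real_complex R)) -(sum_indic_cell n x0 xb) rmorph_sum /=.
rewrite scaler_suml -sumrB; apply: le_trans (nrm_sum _ _) _.
rewrite -[leRHS]mul1r -(sum_indic_cell n x0 xb) mulr_suml.
rewrite big_seq [leRHS]big_seq; apply: ler_sum => j.
rewrite mem_index_iota => /andP[_ jn].
rewrite -scalerBr nrmZ ger0_norm ?indicE//.
case: (boolP (x \in _)) => [|_]; last by rewrite !mul0r.
rewrite mem_setE in_itv /= nodeS => /andP[jx xj].
rewrite !mul1r; apply: fw; first by rewrite x0 ltW.
  by rewrite node_ge0// node_le// ltnW.
by rewrite ger0_norm ?subr_ge0// lerBlDl ltW.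
Qed.

End RiemannSums.

(** The infimum of the admissible errors at stage [n] need not be attained, so [n.+1%:R^-1] is
    added; the common admissible error [M] keeps every such set nonempty. *)
Lemma modulus_exists (R : realType) (P : R -> nat -> Prop) (M : R) :
  (forall n, P M n) ->
  (forall e d n, e <= d -> P e n -> P d n) ->
  (forall e n m, (n <= m)%N -> P e n -> P e m) ->
  (forall e, 0 < e -> exists n, P e n) ->
  exists w : nat -> R, [/\ w @ \oo --> 0,
    forall n m, (n <= m)%N -> w m <= w n,
    forall n, 0 <= w n & forall n, P (w n) n].
Proof.
move=> PM Ple Pn Pe; pose X n := [set e : R | 0 <= e /\ P e n].
have X0 n : X n !=set0.
  exists `|M|; split; first exact: normr_ge0.
  exact: Ple (ler_norm M) (PM n).
have Xlb n : has_lbound (X n) by exists 0 => e [].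
have infX n : has_inf (X n) by split.
have inf0 n : 0 <= inf (X n) by apply: lb_le_inf => // e [].
have n0 n : 0 < n.+1%:R^-1 :> R by rewrite invr_gt0.
exists (fun n => inf (X n) + n.+1%:R^-1); split.
- apply/cvgrPdist_lt => e e0; have e20 : 0 < e / 2 by rewrite divr_gt0.
  have [k Pk] := Pe _ e20.
  have := @cvg_harmonic R; move=> /cvgrPdist_lt/(_ _ e20) h.
  near=> n; have kn : (k <= n)%N by near: n; exists k.
  have : inf (X n) <= e / 2.
    apply: ge_inf => //; split; first exact: ltW.
    exact: Pn kn Pk.
  have : `|0 - n.+1%:R^-1| < e / 2 :> R by near: n.
  rewrite !sub0r !normrN !ger0_norm ?addr_ge0 ?(ltW (n0 _))//.
  by move=> h1 h2; rewrite [ltRHS]splitr ler_ltD.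
- move=> n m nm; apply: lerD; last by rewrite lef_pV2 ?posrE// ler_nat.
  apply: lb_le_inf => // e [e0 Pen]; apply: ge_inf => //; split => //.
  exact: Pn nm Pen.
- by move=> n; rewrite addr_ge0// ltW.
- move=> n; have [e [e0 Pen] eX] := inf_adherent (n0 n) (infX n).
  exact: Ple (ltW eX) Pen.
Unshelve. all: by end_near. Qed.

(** Compactness of the rectangle makes continuity in [s] uniform in [t]; [b / n.+1%:R] is the mesh
    of a Riemann sum with [n.+1] nodes. *)
Lemma rectangle_modulus (R : realType) (l : R) (C : {posnum R})
    (F : R * R -> sobolev l C) (T b : R) : 0 < b -> continuous F ->
  exists w : nat -> R, [/\ w @ \oo --> 0,
    forall n m, (n <= m)%N -> w m <= w n,
    forall n, 0 <= w n &
    forall n t s s', 0 <= t <= T -> 0 <= s <= b -> 0 <= s' <= b ->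
      `|s - s'| <= b / n.+1%:R -> sob_norm (F (t, s) - F (t, s')) <= w n].
Proof.
move=> b0 Fc.
pose K := (`[0, T] `*` `[0, b])%classic : set (R * R).
have cK : compact K by apply: compact_setX; exact: segment_compact.
have Fcvg p e : 0 < e -> \forall q \near p, sob_norm (F p - F q) < e.
  by move=> e0; move/sob_cvgP: (Fc p); exact.
(* The global bound provides the admissible error [M + M] at every stage, including the coarse
   ones. *)
have [M FM] : exists M, forall p, K p -> sob_norm (F p) <= M.
  have : \forall n \near \oo, K `<=` [set p | sob_norm (F p) <= n%:R].
    move/compact_near_coveringP: cK; apply => p _.
    have h := Fcvg p 1 ltr01.
    exists ([set q | sob_norm (F p - F q) < 1], [set n | sob_norm (F p) + 1 <= n%:R]).
      by split => //=; exact: nbhs_infty_ger.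
    move=> [q n] /= [h1 h2]; apply: le_trans h2.
    have := sob_normD (F p) (- (F p - F q)); rewrite opprB addrC subrK sob_distC.
    by move=> h3; apply: le_trans h3 _; rewrite lerD2l ltW.
  by move=> [n _ /(_ n (leqnn n)) hM]; exists n%:R; exact: hM.
have b_n : (fun n => b / n.+1%:R : R) @ \oo --> 0.
  have : (fun n => b / n.+1%:R : R) @ \oo --> b * 0.
    by apply: cvgMl_tmp; exact: cvg_harmonic.
  by rewrite mulr0.
have uc e : 0 < e -> \forall n \near \oo, K `<=` [set p | forall s',
    `|p.2 - s'| <= b / n.+1%:R -> sob_norm (F p - F (p.1, s')) <= e].
  move=> e0; have e20 : 0 < e / 2 by rewrite divr_gt0.
  move/compact_near_coveringP: cK; apply => p _.
  have /nbhs_ballP[r /= r0 hr] := Fcvg p _ e20.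
  have r20 : 0 < r / 2 by rewrite divr_gt0.
  exists (ball p (r / 2), [set n | b / n.+1%:R < r / 2]).
    split => /=; first exact: nbhsx_ballx.
    move/cvgrPdist_lt: b_n => /(_ _ r20); apply: filterS => n.
    by rewrite sub0r normrN; apply: le_lt_trans; exact: ler_norm.
  move=> [q n] /= [[q1 q2] dr] s' qs.
  apply: le_trans (sob_dist_triangle (F p) _ _) _.
  rewrite [leRHS]splitr sob_distC lerD//; apply/ltW/hr.
    by split; [apply: le_ball q1|apply: le_ball q2];
      rewrite ler_pdivrMr// ler_peMr ?ler1n// ltW.
  split => /=.
    by apply: le_ball q1; rewrite ler_pdivrMr// ler_peMr ?ler1n// ltW.
  rewrite /ball /= in q2 *.
  rewrite (_ : p.2 - s' = (p.2 - q.2) + (q.2 - s')); last by ring.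
  apply: le_lt_trans (ler_normD _ _) _; rewrite [ltRHS]splitr ltrD//.
  exact: le_lt_trans dr.
pose P (e : R) (n : nat) := forall t s s', 0 <= t <= T -> 0 <= s <= b ->
  0 <= s' <= b -> `|s - s'| <= b / n.+1%:R -> sob_norm (F (t, s) - F (t, s')) <= e.
have [|||e e0|w [w1 w2 w3 w4]] := @modulus_exists R P (M + M).
- move=> n t s s' t01 s01 s01' _; apply: le_trans (sob_normD _ _) _.
  by rewrite sob_normN lerD// FM//; split; rewrite /= in_itv.
- by move=> e d n ed h t s s' *; apply: le_trans ed; exact: h.
- move=> e n m nm h t s s' ? ? ? hs; apply: h => //; apply: le_trans hs _.
  by rewrite ler_pM2l// lef_pV2 ?posrE// ler_nat.
- have [n _ /(_ n (leqnn n)) h] := uc e e0.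
  exists n => t s s' t01 s01 s01' ss'.
  have Kts : K (t, s) by split; rewrite /= in_itv.
  exact: (h _ Kts s' ss').
by exists w.
Qed.

(** * The local problem *)

Lemma cvg_real_complex (R : realType) (T : Type) (F : set_system T)
    (FF : Filter F) (a : T -> R) (a0 : R) :
  a @ F --> a0 -> (fun x => (a x)%:C%C : R[i]^o) @ F --> (a0%:C%C : R[i]^o).
Proof.
move=> /cvgrPdist_lt h; apply/cvgrPdist_lt => e; rewrite ltcE /= => /andP[/eqP e1 /h].
apply: filterS => x hx; rewrite -rmorphB /= normc_def /= expr0n addr0 sqrtr_sqr.
by rewrite ltcE /= -e1 eqxx.
Qed.

Section RiemannSobolev.
Variables (R : realType) (l : R) (C : {posnum R}).
Local Notation H := (sobolev l C).
Local Notation mu := (@lebesgue_measure R).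
Variables (f : R -> H) (tau : R) (w : nat -> R).
Hypothesis tau_ge0 : 0 <= tau.
Hypothesis w_ge0 : forall n, 0 <= w n.
Hypothesis f_w : forall n s s', 0 <= s <= tau -> 0 <= s' <= tau ->
  `|s - s'| <= tau / n.+1%:R -> sob_norm (f s - f s') <= w n.

Let mu_itv : mu `[0, tau]%classic = tau%:E.
Proof.
rewrite lebesgue_measure_itv /= lte_fin -EFinD subr0; case: ifPn => //.
by rewrite -leNgt => h; congr EFin; apply/eqP; rewrite eq_le h tau_ge0.
Qed.

Let mu_itv_fin : (mu `[0%R, tau]%classic < +oo)%E.
Proof. by rewrite mu_itv ltry. Qed.

Let f_simple n x : `[0, tau]%classic x ->
  complex.Re `|f x - simple_fun (riemann_simple f tau n) x| <= w n.
Proof.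
rewrite /= in_itv /= => x01.
apply: (@riemann_simple_dist _ _ f tau n (w n) tau_ge0 (w_ge0 n) _ x x01).
exact: f_w.
Qed.

(** Both sums are compared through [f] itself rather than through a common refinement, so [n] and
    [m] may be unrelated. *)
Lemma riemann_cauchy n m :
  sob_norm (riemann_sum f tau n - riemann_sum f tau m) <= (w n + w m) * tau.
Proof.
have := simple_integral_dist (mu := mu) (f := f) (measurable_itv _) mu_itv_fin
  (riemann_simple_on (f := f) (n := n) tau_ge0)
  (riemann_simple_on (f := f) (n := m) tau_ge0) (w_ge0 m)
  (@f_simple m).
rewrite !riemann_simple_integral// => h; rewrite -lee_fin; apply: le_trans h _.
rewrite mulrDl EFinD [X in ((w m)%:E * X)%E]mu_itv -EFinM leeD2r//.
apply: (@le_trans _ _ (\int[mu]_(x in `[0%R, tau]) (w n)%:E)%E).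
  apply: ge0_le_integral_any => x x01; rewrite lee_fin ?nrm_ge0//.
  exact: f_simple.
by rewrite integral_cst//= [X in (_ * X)%E]mu_itv.
Qed.

Lemma riemann_bochner I : w @ \oo --> 0 ->
  bochner_integral mu `[0, tau]%classic f I <->
  riemann_sum f tau n @[n --> \oo] --> I.
Proof.
move=> w0; have := bochner_integral_uniform (mu := mu) I (measurable_itv _) mu_itv_fin
  (fun n => riemann_simple_on (f := f) (n := n) tau_ge0) w0 f_simple.
have -> // : (fun n => simple_integral mu (riemann_simple f tau n)) =
  riemann_sum f tau.
by apply/funext => n; rewrite riemann_simple_integral.
Qed.

End RiemannSobolev.

Section LocalProblem.
Variables (R : realType) (L l : R) (C : {posnum R}).
Hypothesis L_gt0 : 0 < L.
Hypothesis C_large : sob_constant L l C.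
Variables (alpha : nat -> nat -> R[i]) (rho : R[i] -> R[i]) (Rad : \bar R).
Hypothesis rho_series : has_power_series alpha rho Rad.
Local Notation H := (sobolev l C).
Local Notation S := (@schrodinger R L l C).
Local Notation mu := (@lebesgue_measure R).
Local Notation tauP := (tau_period L).

Lemma tau_period_gt0 : 0 < tauP.
Proof. by rewrite divr_gt0 ?exprn_gt0// mulr_gt0// pi_gt0. Qed.

Variables (T : R) (U : R -> H).
Hypothesis U_cont : continuous U.
Hypothesis U_ball : forall t, ((sob_norm (U t))%:E < Rad)%E.

Definition duhamel t tau s : H :=
  S (tau - s) (sob_comp L rho (S s (U t))).

(** The integrand without its outer [S tau]: as [S tau] is an isometry, one modulus for [F] serves
    every [tau]. *)
Let F (p : R * R) : H := S (- p.2) (sob_comp L rho (S p.2 (U p.1))).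

Let F_cvg (X : Type) (G : set_system X) (FG : Filter G) (p : X -> R * R) q :
  p @ G --> q -> (fun x => F (p x)) @ G --> F q.
Proof.
move=> pq; have p1 : (fun x => (p x).1) @ G --> q.1.
  exact: cvg_comp pq cvg_fst.
have p2 : (fun x => (p x).2) @ G --> q.2 by exact: cvg_comp pq cvg_snd.
apply: schrodinger_cvg; first exact: cvgN.
apply: (sob_comp_cvg C_large rho_series); first by rewrite schrodinger_norm.
apply: schrodinger_cvg => //.
by apply: continuous_cvg => //; exact: U_cont.
Qed.

Let duhamelE t tau s : duhamel t tau s = S tau (F (t, s)).
Proof. by rewrite /F schrodingerA. Qed.

Lemma duhamel_modulus : exists w : nat -> R, [/\ w @ \oo --> 0,
    forall n m, (n <= m)%N -> w m <= w n, forall n, 0 <= w n &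
    forall n t tau s s', 0 <= t <= T -> 0 <= tau <= tauP ->
      0 <= s <= tau -> 0 <= s' <= tau -> `|s - s'| <= tau / n.+1%:R ->
      sob_norm (duhamel t tau s - duhamel t tau s') <= w n].
Proof.
have [|w [w1 w2 w3 w4]] := @rectangle_modulus _ _ _ F T _ tau_period_gt0.
  by move=> p; apply: F_cvg; exact: cvg_id.
exists w; split => // n t tau s s' tT /andP[tau0 tauP0] /andP[s0 st] /andP[s'0 s't] ss'.
rewrite !duhamelE -schrodingerB schrodinger_norm; apply: w4 => //.
- by rewrite s0 (le_trans st).
- by rewrite s'0 (le_trans s't).
- by apply: le_trans ss' _; rewrite ler_wpM2r// invr_ge0.
Qed.

Lemma duhamel_exists : exists W : R * R -> H,
  [/\ {within `[0, T] `*` `[0, tauP], continuous W},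
      forall t, t \in `[0, T] -> W (t, 0) = 0 &
      forall t tau, t \in `[0, T] -> tau \in `[0, tauP] ->
        bochner_integral mu `[0, tau]%classic (duhamel t tau) (W (t, tau))].
Proof.
have [w [w0 wle w_ge0 hw]] := duhamel_modulus.
pose RS n (p : R * R) := riemann_sum (duhamel p.1 p.2) p.2 n.
pose K := (`[0, T] `*` `[0, tauP])%classic : set (R * R).
have KP p : K p -> 0 <= p.1 <= T /\ 0 <= p.2 <= tauP.
  by move=> [] /=; rewrite !in_itv.
(* For [n <= m] the Cauchy bound [(w n + w m) * tau] is at most this, because [w] decreases. *)
pose eps n := (2 * tauP) * w n.
have tP0 := tau_period_gt0.
have eps0 : eps @ \oo --> 0.
  have : eps @ \oo --> 2 * tauP * 0 by apply: cvgMl_tmp.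
  by rewrite mulr0.
have ex p : exists y, K p -> forall n, sob_norm (RS n p - y) <= eps n.
  have [/KP [p1 p2]|nKp] := pselect (K p); last by exists 0.
  have /andP[tau0 tauP0] := p2.
  have [|y hy] := @sob_complete R l C (RS^~ p) eps eps0; last by exists y.
  move=> n m nm.
  apply: le_trans (riemann_cauchy tau0 w_ge0 _ _ _) _.
    by move=> k s s' s01 s01' ss'; exact: hw.
  have := wle _ _ nm; have := w_ge0 n; have := w_ge0 m; rewrite /eps; nra.
have [W hW] := choice ex; exists W; split.
- apply/subspace_continuousP => p Kp; apply/sob_cvgP => e e0.
  have e30 : 0 < e / 3 by rewrite divr_gt0.
  have arith z : z < e / 3 -> z + (e / 3 + z) < e by lra.
  have [n _ /(_ n (leqnn n))] : \forall n \near \oo, `|0 - eps n| < e / 3.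
    by move/cvgrPdist_lt : eps0; exact.
  rewrite sub0r normrN => /(le_lt_trans (ler_norm _)) en.
  (* The nodes scale with [tau], so each Riemann sum is continuous in both variables; the uniform
     error [eps n] passes this on to [W]. *)
  have RSc : RS n @ within K (nbhs p) --> RS n p.
    apply: cvg_within_filter.
    rewrite /RS /riemann_sum.
    have c1 : (fun q : R * R => q.1) @ p --> p.1 by exact: cvg_fst.
    have c2 : (fun q : R * R => q.2) @ p --> p.2 by exact: cvg_snd.
    have cn j : (fun q : R * R => node q.2 n j) @ p --> node p.2 n j.
      by apply: cvgMl_tmp; exact: cvgMr_tmp.
    apply: (@cvgZ _ _ _ _ _ (fun q : R * R => (q.2 / n.+1%:R)%:C%C)).
      by apply: cvg_real_complex; exact: cvgMr_tmp.
    apply: (@cvg_sum_seq _ _ _ _ _ _ _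
      (fun (j : 'I_n.+1) q => duhamel q.1 q.2 (node q.2 n j))
      (fun j => duhamel p.1 p.2 (node p.2 n j))) => j.
    rewrite duhamelE; under eq_fun do rewrite duhamelE.
    apply: schrodinger_cvg => //.
    apply: (@F_cvg _ _ _ (fun q : R * R => (q.1, node q.2 n j))
      (p.1, node p.2 n j)); exact: (cvg_pair c1 (cn j)).
  have near1 := (sob_cvgP _ _ _).1 RSc _ e30.
  have hp := hW p Kp n.
  near=> q.
  have Kq : K q by near: q; exact: withinT.
  have hq := hW q Kq n.
  have h1 : sob_norm (RS n p - RS n q) < e / 3 by near: q; exact: near1.
  apply: le_lt_trans (sob_dist_triangle (RS n p) _ _) _.
  rewrite [sob_norm (W p - _)]sob_distC.
  have h2 := le_trans (sob_dist_triangle (RS n q) (RS n p) (W q))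
    (lerD (ltW h1) hq).
  exact: le_lt_trans (lerD hp h2) (arith _ en).
- move=> t tT; apply: sob_norm_eq0; apply/eqP.
  rewrite eq_le sob_norm_ge0 andbT; apply/ler_addgt0Pr => e e0; rewrite add0r.
  have Kp : K (t, 0) by split => //=; rewrite in_itv /= lexx ltW.
  have [n _ /(_ n (leqnn n))] : \forall n \near \oo, `|0 - eps n| < e.
    by move/cvgrPdist_lt : eps0; exact.
  rewrite sub0r normrN => /(le_lt_trans (ler_norm _))/ltW; apply: le_trans.
  have := hW _ Kp n; rewrite /RS /riemann_sum mul0r scale0r sub0r.
  by rewrite sob_normN.
move=> t tau tT ttau; have Kp : K (t, tau) by split.
have [p1 p2] := KP _ Kp; have /andP[tau0 _] := p2.
apply/(riemann_bochner tau0 w_ge0 _ _ w0).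
  by move=> k s s' s01 s01' ss'; exact: hw.
apply/sob_cvgP => e e0; move/cvgrPdist_lt: eps0 => /(_ _ e0).
apply: filterS => n; rewrite sub0r normrN => /(le_lt_trans (ler_norm _)).
by apply: le_lt_trans; rewrite sob_distC; exact: hW Kp n.
Unshelve. all: by end_near. Qed.

End LocalProblem.

(** * Sampling of characters *)

(** A geometric sum of an [n.+1]-th root of unity vanishes unless the root is 1. The bound on [D]
    excludes aliasing, that is, a nonzero multiple of [n.+1]; negative [D] reduces to positive by
    conjugation. *)
Lemma expi_average (R : realType) (n : nat) (D : int) :
  (`|D| < n.+1)%N ->
  \sum_(j < n.+1) expi (j%:R * (2 * pi * D%:~R / n.+1%:R) : R) =
  (if D == 0 then n.+1%:R else 0).
Proof.
move=> Dn; case: eqP => [->|/eqP D0].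
  under eq_bigr do rewrite mulr0 mul0r mulr0 expi0.
  by rewrite sumr_const card_ord.
under eq_bigr do rewrite expi_natmul.
set z := expi _; have z1 : z ^+ n.+1 = 1.
  by rewrite -expi_natmul mulrC divfK ?pnatr_eq0// expi_2piz.
have zN1 : z != 1.
  have absn (k : nat) : (0 < k < n.+1)%N ->
      expi (2 * pi * k%:R / n.+1%:R : R) != 1.
    move=> /andP[k0 kn]; apply: expi_neq1; rewrite divr_gt0 ?mulr_gt0 ?pi_gt0 ?ltr0n//=.
    by rewrite ltr_pdivrMr ?ltr0n// ltr_pM2l ?mulr_gt0 ?pi_gt0// ltr_nat.
  rewrite /z; case: D D0 Dn {z z1} => k; rewrite ?NegzE ?abszN /= => k0 kn.
    by apply: absn; rewrite lt0n kn andbT.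
  rewrite mulrNz mulrN mulNr expiN; apply: contra (absn k.+1 kn) => /eqP h.
  by rewrite -[expi _]conjcK h conjc1.
have := subrX1 z n.+1; rewrite z1 subrr => /esym/eqP.
by rewrite mulf_eq0 subr_eq0 (negbTE zN1) /= => /eqP.
Qed.

Section Boxes.
Variables (a b : nat).
Local Notation index := ({ffun 'I_a -> int} * {ffun 'I_b -> int})%type.
Implicit Types (jk : index) (B : {fset int}).

(** Multi-indices with entries in [B] are enumerated through functions into the finite type [B], for
    which powers of sums expand by distributivity. *)
Definition box_seq B : seq index :=
  [seq ([ffun m => val (phi m)], [ffun m => val (psi m)])
  | phi : {ffun 'I_a -> B} <- enum {: {ffun 'I_a -> B}},
    psi : {ffun 'I_b -> B} <- enum {: {ffun 'I_b -> B}}].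

Definition box B : {fset index} := [fset jk in box_seq B]%fset.

Lemma box_seq_uniq B : uniq (box_seq B).
Proof.
apply: allpairs_uniq; rewrite ?enum_uniq//.
move=> -[p1 p2] [q1 q2] _ _ /= [/ffunP h1 /ffunP h2].
congr pair; apply/ffunP => m; apply: val_inj.
  by have := h1 m; rewrite !ffunE.
by have := h2 m; rewrite !ffunE.
Qed.

Lemma mem_box B jk :
  (forall m, jk.1 m \in B) -> (forall m, jk.2 m \in B) -> jk \in box B.
Proof.
case: jk => j k /= jB kB; rewrite inE /=; apply/allpairsP.
exists ([ffun m => [` jB m]%fset], [ffun m => [` kB m]%fset]).
by split; rewrite ?mem_enum//=; congr pair; apply/ffunP => m; rewrite !ffunE.
Qed.

Lemma box_sum (V : comNzRingType) B (c d : int -> V) :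
  \sum_(jk <- box B) ((\prod_m c (jk.1 m)) * \prod_m d (jk.2 m)) =
  (\sum_(K <- B) c K) ^+ a * (\sum_(K <- B) d K) ^+ b.
Proof.
rewrite (perm_big (box_seq B)); last first.
  by apply: uniq_perm; rewrite ?fset_uniq ?box_seq_uniq// => jk; rewrite inE.
have pow n (e : int -> V) : (\sum_(K <- B) e K) ^+ n =
    \sum_(phi : {ffun 'I_n -> B}) \prod_m e (val (phi m)).
  rewrite big_seq_fsetE /= -(bigA_distr_bigA (fun (m : 'I_n) (K : B) => e (val K))).
  by rewrite prodr_const card_ord.
rewrite !pow big_distrlr /= /box_seq big_allpairs_dep /= big_enum /=.
apply: eq_bigr => phi _; rewrite big_enum /=; apply: eq_bigr => psi _.
by congr (_ * _); apply: eq_bigr => m _; rewrite ffunE.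
Qed.

Definition values jk : {fset int} :=
  ([fset jk.1 m | m in 'I_a] `|` [fset jk.2 m | m in 'I_b])%fset.

Lemma box_values B jk : (values jk `<=` B)%fset -> jk \in box B.
Proof.
move=> /fsubsetP h; apply: mem_box => m; apply: h; rewrite inE; apply/orP.
  by left; apply/imfsetP; exists m.
by right; apply/imfsetP; exists m.
Qed.

(** Boxes are cofinal among finite sets of multi-indices, so absolutely convergent sums may be
    exhausted along boxes. *)
Lemma fset_in_box (X : {fset index}) :
  exists B0, forall B, (B0 `<=` B)%fset -> (X `<=` box B)%fset.
Proof.
exists (\bigcup_(jk <- X) values jk)%fset => B XB; apply/fsubsetP => jk jkX.
by apply: box_values; apply: fsubset_trans XB; exact: bigfcup_sup.
Qed.

End Boxes.

(** * Resonant terms *)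

Section Resonance.
Variables (R : realType) (L l : R) (C : {posnum R}).
Hypothesis L_gt0 : 0 < L.
Hypothesis C_large : sob_constant L l C.
Variables (alpha : nat -> nat -> R[i]) (rho : R[i] -> R[i]) (Rad : \bar R).
Hypothesis rho_series : has_power_series alpha rho Rad.
Local Notation H := (sobolev l C).
Local Notation sf := (@sob_fun R L l C).
Local Notation S := (@schrodinger R L l C).
Local Notation mu := (@lebesgue_measure R).
Local Notation tauP := (tau_period L).
Local Notation index ab := ({ffun 'I_ab.1 -> int} * {ffun 'I_ab.2 -> int})%type.
Variable u : H.
Implicit Types (A : {fset nat * nat}) (B : {fset int}) (ab : nat * nat) (K : int).

Definition coef_prod ab (jk : index ab) : R[i] :=
  \prod_m (u (jk.1 m) : R[i]) * \prod_m (u (jk.2 m) : R[i])^*%C.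

Definition momentum ab (jk : index ab) : int := \sum_m jk.1 m - \sum_m jk.2 m.

Definition energy ab (jk : index ab) : int :=
  \sum_m jk.1 m ^+ 2 - \sum_m jk.2 m ^+ 2.

(* [S_(-s) (S_s u)^a (conj (S_s u))^b] oscillates with frequency [defect], and
   [jk] is resonant for [K = momentum jk] when [defect jk = 0]. *)
Definition defect ab (jk : index ab) : int := momentum jk ^+ 2 - energy jk.

Definition phase (s : R) (m : int) : R[i] :=
  expi (s * (2 * pi / L) ^+ 2 * m%:~R).

(** This is the expansion of [series_poly alpha A] at [S s (trunc B u)], as [box_approx_fun] shows:
    a finite combination of exponentials, on which the group acts by explicit phases. *)
Definition box_approx A B (s : R) : H :=
  \sum_(ab <- A) alpha ab.1 ab.2 *: \sum_(jk <- box ab.1 ab.2 B)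
    (coef_prod jk * phase (- s) (energy jk)) *: basis l C (momentum jk).

Lemma phaseD s m1 m2 : phase s (m1 + m2) = phase s m1 * phase s m2.
Proof. by rewrite /phase rmorphD /= mulrDr expiD. Qed.

Lemma phaseN s m : phase s (- m) = (phase s m)^*%C.
Proof. by rewrite /phase rmorphN /= mulrN expiN. Qed.

Lemma phase_sum s (I : Type) (r : seq I) (f : I -> int) :
  phase s (\sum_(i <- r) f i) = \prod_(i <- r) phase s (f i).
Proof.
elim: r => [|i r IH]; last by rewrite !big_cons phaseD IH.
by rewrite !big_nil /phase mulr0 expi0.
Qed.

Lemma phase_coef s v K : S s v K = phase (- s) (K ^+ 2) * (v K : R[i]) :> R[i].
Proof.
rewrite coef_schrodinger /phase; congr (expi _ * _).
by move: (pi) => p; rewrite rmorphXn /=; field; rewrite gt_eqF.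
Qed.

Definition wave (x : R) (m : int) : R[i] := expi (2 * pi * m%:~R * x / L).

Lemma waveD x m1 m2 : wave x (m1 + m2) = wave x m1 * wave x m2.
Proof. by rewrite /wave rmorphD /= mulrDr !mulrDl expiD. Qed.

Lemma waveN x m : wave x (- m) = (wave x m)^*%C.
Proof. by rewrite /wave rmorphN /= mulrN !mulNr expiN. Qed.

Lemma wave_sum x (I : Type) (r : seq I) (f : I -> int) :
  wave x (\sum_(i <- r) f i) = \prod_(i <- r) wave x (f i).
Proof.
elim: r => [|i r IH]; last by rewrite !big_cons waveD IH.
by rewrite !big_nil /wave mulr0 !mul0r expi0.
Qed.

Lemma box_approx_fun A B s x :
  sf (box_approx A B s) x = series_poly alpha A (sf (S s (trunc B u)) x).
Proof.
pose c K : R[i] := (u K : R[i]) * phase (- s) (K ^+ 2) * wave x K.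
have -> : sf (S s (trunc B u)) x = \sum_(K <- B) c K.
  rewrite (@sob_fun_fin _ _ _ _ B); last first.
    by move=> K KB; rewrite phase_coef coef_trunc (negbTE KB) mulr0.
  rewrite big_seq [RHS]big_seq; apply: eq_bigr => K KB.
  by rewrite phase_coef coef_trunc KB /c [phase _ _ * _]mulrC.
rewrite (sob_fun_sum C_large); apply: eq_bigr => ab _.
rewrite (sob_funZ C_large); congr (_ * _); rewrite (sob_fun_sum C_large).
rewrite /monomial rmorph_sum /= -(box_sum _ _ B c (fun K => (c K)^*%C)).
apply: eq_bigr => jk _; rewrite (sob_funZ C_large) sob_fun_basis.
rewrite -/(wave x (momentum jk)) /momentum /energy waveD waveN phaseD phaseN.
rewrite !wave_sum !phase_sum !rmorph_prod /= /coef_prod /c !big_split /=.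
under [X in _ = _ * X]eq_bigr do rewrite !rmorphM /=.
by rewrite !big_split /=; ring.
Qed.

(** Periodicity removes [tauP]; the group then contributes the square of the momentum to the phase,
    which combines with the energy into the defect. *)
Lemma box_approx_shift A B s : S (tauP - s) (box_approx A B s) =
  \sum_(ab <- A) alpha ab.1 ab.2 *: \sum_(jk <- box ab.1 ab.2 B)
    (coef_prod jk * phase s (defect jk)) *: basis l C (momentum jk).
Proof.
rewrite schrodinger_period// schrodinger_sum; apply: eq_bigr => ab _.
rewrite schrodingerZ schrodinger_sum; congr (_ *: _); apply: eq_bigr => jk _.
rewrite schrodingerZ schrodinger_basis scalerA -mulrA; congr ((_ * _) *: _).
have -> : phase (- s) (energy jk) = phase s (- energy jk).
  by rewrite /phase rmorphN /= mulrN !mulNr.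
rewrite /defect phaseD mulrC; congr (_ * _); rewrite /phase.
congr expi; move: (pi) => p; rewrite rmorphXn /=; field.
by rewrite gt_eqF.
Qed.

Definition resonant_approx A B : H :=
  \sum_(ab <- A) alpha ab.1 ab.2 *: \sum_(jk <- box ab.1 ab.2 B)
    (coef_prod jk * (defect jk == 0)%:R) *: basis l C (momentum jk).

(** The equality is exact: a finite sum has a largest defect in absolute value, and that many
    subdivisions already suffice. *)
Lemma box_approx_average A B : exists n0, forall n, (n0 <= n)%N ->
  riemann_sum (fun s => S (tauP - s) (box_approx A B s)) tauP n =
  (tauP%:C)%C *: resonant_approx A B.
Proof.
exists (\max_(ab <- A) \max_(jk <- box ab.1 ab.2 B) `|defect jk|%N).
move=> n n0n; rewrite /riemann_sum.
under eq_bigr do rewrite box_approx_shift.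
rewrite exchange_big /= scaler_sumr /resonant_approx scaler_sumr.
rewrite big_seq [RHS]big_seq; apply: eq_bigr => ab abA.
rewrite -scaler_sumr [LHS]scalerA [RHS]scalerA [X in X *: _ = _]mulrC.
rewrite [X in _ = X *: _]mulrC -[LHS]scalerA -[RHS]scalerA; congr (_ *: _).
rewrite exchange_big /= !scaler_sumr.
rewrite big_seq [RHS]big_seq; apply: eq_bigr => jk jkB.
rewrite -scaler_suml !scalerA; congr (_ *: _).
rewrite -mulr_sumr mulrCA [RHS]mulrCA; congr (_ * _).
have Dn : (`|defect jk| < n.+1)%N.
  rewrite ltnS (leq_trans _ n0n)//.
  apply: (leq_trans _ (leq_bigmax_seq ab abA isT)).
  exact: (leq_bigmax_seq jk jkB isT).
under eq_bigr => j _.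
  rewrite /phase (_ : node _ _ _ * _ * _ =
    j%:R * (2 * pi * (defect jk)%:~R / n.+1%:R)); last first.
    rewrite /node /tau_period; move: (pi) (pi_gt0 R) => p p0; field.
    by rewrite nat1r pnatr_eq0 !gt_eqF.
  over.
rewrite expi_average//; case: eqP => _; last by rewrite !mulr0.
by rewrite mulr1 -(rmorph_nat (@real_complex R)) -rmorphM /= divfK ?pnatr_eq0.
Qed.

Lemma coef_resonant_approx A B K : resonant_approx A B K =
  \sum_(ab <- A) alpha ab.1 ab.2 *
    \sum_(jk <- [fset jk in box ab.1 ab.2 B | (momentum jk == K) &&
      (energy jk == K ^+ 2)]%fset) coef_prod jk :> R[i].
Proof.
rewrite coef_sum; apply: eq_bigr => ab _; rewrite coefZ coef_sum; congr (_ * _).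
rewrite -big_fset_condE [RHS]big_mkcond /=; apply: eq_bigr => jk _.
rewrite coefZ basisE /defect [K == _]eq_sym -mulrA -natrM mulnb andbC subr_eq0.
rewrite [_ == energy jk]eq_sym; case: eqP => [->|_] /=; last by rewrite mulr0.
by case: eqP; rewrite ?mulr1 ?mulr0.
Qed.

(** Enlarging [X] to a box factors the sum into powers of the l^1 norm of the coefficients, which
    [sob_l1] bounds. *)
Lemma coef_prod_bound ab (X : {fset index ab}) :
  \sum_(jk <- X) normc (coef_prod jk) <= sob_norm u ^+ (ab.1 + ab.2).
Proof.
have [B0 hB] := fset_in_box X; have {hB}XB := hB B0 (fsubset_refl _).
apply: le_trans (fset_sum_le (fun jk => normc_ge0 (coef_prod jk)) XB) _.
under eq_bigr do rewrite normcM !normc_prod.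
under eq_bigr => jk _ do under [X in _ * X]eq_bigr do rewrite normc_conj.
rewrite (box_sum _ _ B0 (fun K => normc (u K)) (fun K => normc (u K))) -exprD.
rewrite lerXn2r ?nnegrE ?sob_norm_ge0 ?(sob_l1 C_large)//.
by apply: sumr_ge0 => K _; exact: normc_ge0.
Qed.

Let resonant_sum ab K : R[i] :=
  csum (@resonant_set ab.1 ab.2 K) (@coef_prod ab).

Lemma resonant_coefE K : resonant_coef alpha u K =
  csum degree_ge2 (fun ab => alpha ab.1 ab.2 * resonant_sum ab K) :> R[i].
Proof. by []. Qed.

Let coef_prod_abs ab K : abs_bounded (@resonant_set ab.1 ab.2 K)
  (@coef_prod ab) (sob_norm u ^+ (ab.1 + ab.2)).
Proof. by move=> X _; exact: coef_prod_bound. Qed.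

Let resonant_sum_bound ab K :
  normc (resonant_sum ab K) <= sob_norm u ^+ (ab.1 + ab.2).
Proof.
(* With the empty set as [A], the tail estimate bounds the whole sum. *)
have h0 : [set` (fset0 : {fset index ab})] `<=` @resonant_set ab.1 ab.2 K.
  by move=> jk; rewrite /= inE.
have := csum_tail (@coef_prod_abs ab K) h0 (e := sob_norm u ^+ (ab.1 + ab.2)).
rewrite big_seq_fset0 subr0; apply => X _ _; exact: coef_prod_bound.
Qed.

Let resonant_sum_approx ab K (d : R) : 0 < d ->
  exists B0, forall B, (B0 `<=` B)%fset ->
    normc (resonant_sum ab K -
      \sum_(jk <- [fset jk in box ab.1 ab.2 B | (momentum jk == K) &&
        (energy jk == K ^+ 2)]%fset) coef_prod jk) <= d.
Proof.
move=> d0; have [X XD hX] := csum_approx d0 (@coef_prod_abs ab K).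
have [B0 hB] := fset_in_box X; exists B0 => B /hB XB; apply: hX.
  apply/fsubsetP => jk jkX; have := fsubsetP XB jk jkX; rewrite !inE /= => -> /=.
  have [h1 h2] := XD jk jkX.
  by rewrite /momentum /energy -h1 -h2 !eqxx.
by move=> jk; rewrite /= !inE /= => /andP[_ /andP[/eqP h1 /eqP h2]]; split.
Qed.

Hypothesis u_ball : ((sob_norm u)%:E < Rad)%E.

Lemma resonant_coef_approx A K (e : R) : 0 < e -> [set` A] `<=` degree_ge2 ->
  abs_tail degree_ge2 (majorant alpha (sob_norm u)) A e ->
  exists B0, forall B, (B0 `<=` B)%fset ->
    normc ((resonant_coef alpha u K : R[i]) - resonant_approx A B K) <= e + e.
Proof.
move=> e0 AD Ae; have r0 := sob_norm_ge0 u.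
pose M := \sum_(ab <- A) normc (alpha ab.1 ab.2).
have M0 : 0 <= M by apply: sumr_ge0 => ab _; exact: normc_ge0.
(* One [e] pays for the degrees outside [A]; the other is shared among the inner sums, whose
   coefficients have total modulus [M]. *)
have d0 : 0 < e / (1 + M) by rewrite divr_gt0// ltr_pwDl.
have [B1 hB1] := choice (fun ab => resonant_sum_approx ab K d0).
exists (\bigcup_(ab <- A) B1 ab)%fset => B BB.
have [M' hM'] := majorant_bounded rho_series r0 u_ball.
have le ab : normc (alpha ab.1 ab.2 * resonant_sum ab K) <=
    normc (majorant alpha (sob_norm u) ab).
  by rewrite normc_majorant// normcM ler_wpM2l ?normc_ge0.
have h1 : normc ((resonant_coef alpha u K : R[i]) -
    \sum_(ab <- A) alpha ab.1 ab.2 * resonant_sum ab K) <= e.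
  rewrite resonant_coefE; apply: (@csum_tail _ _ _ _ M') => // [X XD|X XD AX].
    by apply: le_trans (hM' X XD); apply: ler_sum => ab _; exact: le.
  by apply: le_trans (Ae X XD AX); apply: ler_sum => ab _; exact: le.
rewrite -[X in normc (X - _)](subrK (\sum_(ab <- A)
  alpha ab.1 ab.2 * resonant_sum ab K)) -addrA.
apply: le_trans (normc_triangle _ _) _; apply: lerD h1 _.
rewrite coef_resonant_approx -sumrB; apply: le_trans (normc_sum _ _) _.
apply: (@le_trans _ _ (M * (e / (1 + M)))).
  rewrite mulr_suml big_seq [leRHS]big_seq; apply: ler_sum => ab abA.
  rewrite -mulrBr normcM ler_wpM2l ?normc_ge0//; apply: hB1.
  by apply: fsubset_trans BB; exact: bigfcup_sup.
rewrite mulrCA ler_piMr ?ltW// ltr_pdivrMr ?ltr_pwDl// mul1r.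
by rewrite ltrDr.
Qed.

(** [B0] does not depend on [s]: the tail bound holds on the whole ball, and the error
    [S s u - S s (trunc B u)] has the norm of [u - trunc B u]. *)
Lemma duhamel_box_approx A (e : R) : 0 < e -> [set` A] `<=` degree_ge2 ->
  abs_tail degree_ge2 (majorant alpha (sob_norm u)) A e ->
  exists B0, forall B, (B0 `<=` B)%fset -> forall s,
    sob_norm (S (tauP - s) (sob_comp L rho (S s u)) -
      S (tauP - s) (box_approx A B s)) <= e + e.
Proof.
move=> e0 AD Ae; have r0 := sob_norm_ge0 u.
have [M [c [c0 hL]]] := lipschitz_poly C_large alpha (sob_norm u) AD.
have d0 : 0 < e / (1 + c) by rewrite divr_gt0// ltr_pwDl.
have [B0 hB0] := trunc_dense u d0; exists B0 => B /hB0 uB s.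
rewrite -schrodingerB schrodinger_norm.
have vr : sob_norm (S s u) <= sob_norm u by rewrite schrodinger_norm.
have [sE sA] := sob_comp_exists C_large rho_series r0 u_ball vr.
have b1 : sob_bounded L l C (sf (S s u)) (sob_norm u) by exists (S s u).
have b2 : sob_bounded L l C (sf (S s (trunc B u))) (sob_norm u).
  by exists (S s (trunc B u)); rewrite // schrodinger_norm trunc_norm.
have b12 : sob_bounded L l C (fun x => sf (S s u) x - sf (S s (trunc B u)) x)
    (e / (1 + c)).
  exists (S s (u - trunc B u)) => [x|]; last by rewrite schrodinger_norm.
  by rewrite schrodingerB (sob_funB C_large).
have [_ h] := hL _ _ _ b1 b2 b12.
have := sob_boundedD C_large (sA A e AD Ae) h.
move=> /(sob_boundedP C_large (w := sob_comp L rho (S s u) - box_approx A B s)).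
move=> hw; apply: le_trans (hw _) _ => [x|].
  by rewrite (sob_funB C_large) sE box_approx_fun; ring.
rewrite lerD2l mulrCA ler_piMr ?ltW// ltr_pdivrMr ?ltr_pwDl// mul1r.
by rewrite ltrDr.
Qed.

Lemma resonant_average I :
  riemann_sum (duhamel L rho (fun=> u) 0 tauP) tauP n @[n --> \oo] --> I ->
  I = (tauP%:C)%C *: resonant alpha u.
Proof.
move=> /sob_cvgP cI; have tP0 := tau_period_gt0 L_gt0.
have r0 := sob_norm_ge0 u.
have [M hM] := majorant_bounded rho_series r0 u_ball.
have IE K : I K = (tauP%:C)%C * (resonant_coef alpha u K : R[i]) :> R[i].
  apply: normc_small_eq => e0 e00.
  (* The errors to come are [e] for the limit, and [tauP * (e + e)] each for the integrand and for
     the resonant coefficient. *)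
  pose e := e0 / (1 + 4 * tauP).
  have e_gt0 : 0 < e by rewrite divr_gt0// ltr_pwDl// mulr_ge0// ltW.
  have [A AD Ae] := abs_tail_exists e_gt0 hM.
  have [B1 h1] := resonant_coef_approx K e_gt0 AD Ae.
  have [B2 h2] := duhamel_box_approx e_gt0 AD Ae.
  have {}h1 := h1 _ (fsubsetUl B1 B2); have {}h2 := h2 _ (fsubsetUr B1 B2).
  set B := (B1 `|` B2)%fset in h1 h2.
  have [n0 hn] := box_approx_average A B.
  have [m _ hm] := cI _ e_gt0.
  have := hn (maxn n0 m) (leq_maxl _ _); have := hm (maxn n0 m) (leq_maxr _ _).
  move: (maxn n0 m) => n /= Rn Qn.
  have tn0 : 0 <= tauP / n.+1%:R := divr_ge0 (ltW tP0) (ler0n _ _).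
  have h3 : sob_norm (riemann_sum (duhamel L rho (fun=> u) 0 tauP) tauP n -
      (tauP%:C)%C *: resonant_approx A B) <= tauP * (e + e).
    rewrite -Qn /riemann_sum -scalerBr sob_normZr ger0_norm//.
    rewrite -sumrB; apply: (@le_trans _ _ (tauP / n.+1%:R *
        \sum_(j < n.+1) (e + e))).
      rewrite ler_wpM2l//; apply: le_trans (sob_norm_sum _ _) _.
      by apply: ler_sum => j _; exact: h2.
    rewrite sumr_const card_ord -[(e + e) *+ _]mulr_natl mulrA divfK ?pnatr_eq0//.
  have h4 : normc ((I : H) K - (tauP%:C)%C * (resonant_approx A B K : R[i]))
      <= e + tauP * (e + e).
    rewrite -coefZ -coefB; apply: le_trans (normc_coef C_large _ _) _.
    apply: le_trans (sob_dist_triangle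
      (riemann_sum (duhamel L rho (fun=> u) 0 tauP) tauP n) _ _) _.
    by rewrite lerD// ltW.
  rewrite -[X in normc (X - _)](subrK ((tauP%:C)%C *
    (resonant_approx A B K : R[i]))) -addrA -mulrBr.
  have h5 : normc ((tauP%:C)%C * ((resonant_approx A B K : R[i]) -
      resonant_coef alpha u K)) <= tauP * (e + e).
    by rewrite normcM normc_real ger0_norm ?(ltW tP0)// ler_pM2l// normc_distC.
  apply: le_trans (le_trans (normc_triangle _ _) (lerD h4 h5)) _.
  have arith (x y : R) : x + y * (x + x) + y * (x + x) = x * (1 + 4 * y) by ring.
  rewrite arith.
  by rewrite divfK// gt_eqF// ltr_pwDl// mulr_ge0// ltW.
have tauN0 : (tauP%:C)%C != 0 :> R[i] by rewrite fmorph_eq0 gt_eqF.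
(* The resonant coefficients are those of an element of the space, so [insubd] does not return its
   default. *)
have E : resonant_coef alpha u = coef ((tauP%:C)%C^-1 *: I).
  by apply/funext => K; rewrite coefZ IE mulrA mulVf// mul1r.
rewrite /resonant E.
have := @insubdK _ _ (sobolev l C) 0 _ (coefP ((tauP%:C)%C^-1 *: I)).
move=> h; apply: coef_inj => K; rewrite coefZ.
rewrite (_ : coef (insubd 0 _) = val (insubd (0 : H) (coef ((tauP%:C)%C^-1 *: I))))//.
by rewrite h -[in RHS]coefZ scalerA divff// scale1r.
Qed.

End Resonance.

(** * Equivalence of the two problems *)

Lemma bochner_integral_eq d (T : measurableType d) (R : realType)
    (V : normedModType R[i]) (mu : {measure set T -> \bar R}) (D : set T)
    (f g : T -> V) (I : V) :
  (forall x, D x -> g x = f x) ->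
  bochner_integral mu D f I -> bochner_integral mu D g I.
Proof.
move=> gf /(bochner_integralZ (a := 1) (g := g)); rewrite scale1r; apply => x Dx.
by rewrite scale1r gf.
Qed.

Lemma bochner_resonant (R : realType) (L l : R) (C : {posnum R})
    (alpha : nat -> nat -> R[i]) (rho : R[i] -> R[i]) (Rad : \bar R)
    (u I : sobolev l C) :
  0 < L -> sob_constant L l C -> has_power_series alpha rho Rad ->
  ((sob_norm u)%:E < Rad)%E ->
  bochner_integral (@lebesgue_measure R) `[0, tau_period L]%classic
    (fun s => schrodinger L (tau_period L - s)
      (sob_comp L rho (schrodinger L s u))) I ->
  I = ((tau_period L)%:C)%C *: resonant alpha u.
Proof.
move=> L0 CL rs uR.
(* A single datum is treated as a constant path on the time interval reduced to 0, so the modulus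
   for paths applies. *)
have c0 : continuous (fun _ : R => u) by move=> t; exact: cvg_cst.
have [w [w1 _ w3 w4]] := duhamel_modulus L0 CL rs 0 c0 (fun=> uR).
have t0 := ltW (tau_period_gt0 L0).
have h := riemann_bochner (f := duhamel L rho (fun=> u) 0 (tau_period L)) t0 w3 _ I w1.
move=> bI; apply: (resonant_average L0 CL rs uR); apply/h => //.
by move=> n s s' sP sP' ss'; apply: w4; rewrite ?lexx ?t0.
Qed.

(** The path is only given on [[0, T]]; freezing it outside makes it continuous on the line, as the
    joint continuity of the integrand requires. *)
Lemma continuous_clamp (R : realType) (V : topologicalType) (T : R)
    (u : R -> V) : 0 <= T -> {within `[0, T], continuous u} ->
  continuous (fun t => u (Num.max 0 (Num.min t T))).
Proof.
move=> T0 /subspace_continuousP uc t.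
have clampP s : `[0, T]%classic (Num.max 0 (Num.min s T)).
  by rewrite /= in_itv /= le_max lexx /= ge_max T0 ge_min lexx orbT.
have cc : (fun s => Num.max 0 (Num.min s T)) @ t --> Num.max 0 (Num.min t T).
  apply: (@continuous_max _ R (fun=> 0) (fun s => Num.min s T)).
    exact: cvg_cst.
  by apply: (@continuous_min _ R id (fun=> T)); [exact: cvg_id|exact: cvg_cst].
move=> P /(uc _ (clampP t)) /= uP; have := cc _ uP.
by rewrite !nbhs_simpl /=; apply: filterS => s; apply; exact: clampP.
Qed.

Theorem proposition3p1 (R : realType) (L T l : R) (n : nat) (C : {posnum R})
    (L_gt0 : 0 < L) (T_gt0 : 0 < T) (l_gt : 1 / 2 < l)
    (C_large : sob_constant L l C)
    (Dom : set (sobolev l C)) (A : sobolev l C -> sobolev l C)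
    (E : R -> {linear sobolev l C -> sobolev l C})
    (A_gen : is_generator Dom A E)
    (B : R -> {linear sobolev l C -> sobolev l C})
    (B_bounded : forall t, t \in `]0, T[ -> continuous (B t))
    (B_extends : forall t, t \in `]0, T[ ->
       forall u : sobolev (l + n%:R) C, B t (sob_embed u) = E t (dx L u))
    (C' gamma : R) (C'_gt0 : 0 < C') (gamma_ge0 : 0 <= gamma)
    (gamma_lt1 : gamma < 1)
    (B_le : forall t, t \in `]0, T[ -> forall u : sobolev l C,
       sob_norm (B t u) <= C' * t `^ (- gamma) * sob_norm u)
    (rho : R[i] -> R[i]) (alpha : nat -> nat -> R[i]) (Rad : \bar R)
    (Rad_gt0 : (0 < Rad)%E) (rho_analytic : real_analytic rho)
    (rho_series : has_power_series alpha rho Rad)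
    (u : R -> sobolev l C)
    (u_cont : {within `[0, T], continuous u})
    (u_ball : forall t, t \in `[0, T] -> ((sob_norm (u t))%:E < Rad)%E) :
  mild_solution alpha T E B u <->
  exists v w : R * R -> sobolev l C,
  [/\ {within `[0, T] `*` `[0, tau_period L], continuous v},
      {within `[0, T] `*` `[0, tau_period L], continuous w},
      (forall p, (`[0, T] `*` `[0, tau_period L]) p ->
         ((sob_norm (v p))%:E < Rad)%E) &
      extended_mild_solution L rho T E B u v w].
Proof.
have tP0 : 0 < tau_period L := tau_period_gt0 L_gt0.
have tauN0 : ((tau_period L)%:C)%C != 0 :> R[i] by rewrite fmorph_eq0 gt_eqF.
have tauI : tau_period L \in `[0, tau_period L] by rewrite in_itv /= lexx ltW.
have sub s t : s \in `[0, t] -> t \in `[0, T] -> s \in `[0, T].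
  by rewrite !in_itv /= => /andP[-> st] /andP[_]; exact: le_trans st.
split=> [mild|[v [w [_ _ _ [_ ext]]]] t tT]; last first.
  (* The second equation forces [v (s, tau') = S_tau' (u s)], so [w (s, tau_P)] is an integral to
     which [bochner_resonant] applies. *)
  have wE s : s \in `[0, T] ->
      w (s, tau_period L) = ((tau_period L)%:C)%C *: resonant alpha (u s).
    move=> sT; have [_ _ wI] := ext s (tau_period L) sT tauI.
    apply: (bochner_resonant L_gt0 C_large rho_series (u_ball _ sT)).
    apply: bochner_integral_eq wI => s' s'P.
    by have [_ -> _] := ext s s' sT s'P.
  have [[I BI uE] _ _] := ext t (tau_period L) tT tauI.
  exists (((tau_period L)^-1%:C)%C *: I) => //; apply: bochner_integralZ BI => s st.
  rewrite wE ?linearZ/= ?scalerA; last exact: sub st tT.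
  by rewrite mulrC -rmorphM mulVf ?gt_eqF// scale1r.
pose U t := u (Num.max 0 (Num.min t T)).
have UE t : t \in `[0, T] -> U t = u t.
  by rewrite in_itv /= /U => /andP[t0 /min_idPl ->]; move/max_idPr: t0 => ->.
have U_cont : continuous U by apply: continuous_clamp => //; exact: ltW.
have U_ball t : ((sob_norm (U t))%:E < Rad)%E.
  by apply: u_ball; rewrite in_itv /= le_max lexx /= ge_max (ltW T_gt0) ge_min lexx
    orbT.
have [W [Wc W0 WI]] := duhamel_exists L_gt0 C_large rho_series T U_cont U_ball.
(* The witnesses are built from the extended path [U], which agrees with [u] on [[0, T]]. *)
exists (fun p => schrodinger L p.2 (U p.1)), W; split => //.
- apply: continuous_subspaceT => p; apply: schrodinger_cvg; first exact: cvg_snd.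
  by apply: continuous_cvg; [exact: U_cont|exact: cvg_fst].
- by move=> p _; rewrite schrodinger_norm.
split=> [t tT|t tau tT tauT].
  by split; [rewrite /= schrodinger0 UE|exact: W0].
split => /=; last exact: WI; last by rewrite UE.
have [I BI uE] := mild t tT.
(* By linearity of [B (t - s)], the integrand with [w] is [tau_P] times the resonant one; the
   prefactor [tau_P^-1] then restores [I]. *)
exists (((tau_period L)%:C)%C *: I).
  apply: bochner_integralZ BI => s st; have sT := sub _ _ st tT.
  rewrite (bochner_resonant L_gt0 C_large rho_series (U_ball s) (WI s _ sT tauI)).
  by rewrite linearZ/= UE.
by rewrite scalerA -rmorphM mulVf ?gt_eqF// scale1r.
Qed.
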